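(* Let $\{t_i\}_{i=1}^{\infty}$ be dense in $[0,1]$ and suppose that the sequence $\|y_n\|_{W_2^4}$ is bounded, where $y_n=\sum_{i=1}^{n}A_i\bar\psi_i$ are the $n$-term numerical solutions defined in the context. Then $y_n$ converges, in the norm of $W_2^4[0,1]$, to a solution $y\in W_2^4[0,1]$ of $Ty(t)=F(t,y(t),y'(t),y''(t))$, $0\le t\le 1$, with periodic conditions $y(0)-y(1)=0$, $y'(0)-y'(1)=0$, $y''(0)-y''(1)=0$, and $$y(t)=\sum_{i=1}^{\infty}A_i\bar\psi_i(t).$$
   Context: All functions are real-valued. $W_2^4[0,1]$ is the Hilbert space of functions $y$ on $[0,1]$ such that $y,y',y'',y'''$ are absolutely continuous, $y^{(4)}\in L^2[0,1]$, and $y(0)=y(1)$, $y'(0)=y'(1)$, $y''(0)=y''(1)$, with inner product $\langle y,z\rangle_{W_2^4}=\sum_{i=0}^{3}y^{(i)}(0)z^{(i)}(0)+\int_0^1 y^{(4)}(v)z^{(4)}(v)\,dv$ and norm $\|y\|_{W_2^4}=\sqrt{\langle y,y\rangle_{W_2^4}}$. $W_2^1[0,1]$ is the Hilbert space of absolutely continuous functions $y$ on $[0,1]$ with $y'\in L^2[0,1]$ and inner product $\langle y,z\rangle_{W_2^1}=y(0)z(0)+\int_0^1 y'(v)z'(v)\,dv$; its reproducing kernel is $Q_s(t)=1+t$ for $t\le s$, $Q_s(t)=1+s$ for $t>s$. $T:W_2^4[0,1]\to W_2^1[0,1]$ is the bounded linear operator $Ty=y'''$ and $T^*$ is its adjoint.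 $F:[0,1]\times\mathbb{R}^3\to\mathbb{R}$ is continuous and $t\mapsto F(t,v_1(t),v_2(t),v_3(t))$ belongs to $W_2^1[0,1]$ for $v_1,v_2,v_3\in W_2^4[0,1]$. The points $t_1,t_2,\ldots$ are pairwise distinct. Put $\varphi_i=Q_{t_i}$ and $\psi_i=T^*\varphi_i$. The orthonormal system $\{\bar\psi_i\}_{i=1}^\infty$ in $W_2^4[0,1]$ is obtained from $\{\psi_i\}_{i=1}^\infty$ by the Gram–Schmidt process, and $\beta_{ik}$ are the corresponding coefficients: $\bar\psi_i=\sum_{k=1}^{i}\beta_{ik}\psi_k$. The $n$-term numerical solutions are defined recursively by $y_0=0$ and, for $n\ge 1$, $y_n=\sum_{i=1}^{n}A_i\bar\psi_i$ with $A_i=\sum_{k=1}^{i}\beta_{ik}F\big(t_k,y_{k-1}(t_k),y_{k-1}'(t_k),y_{k-1}''(t_k)\big)$. *)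

(* Defs.v *)
From HB Require Import structures.
From mathcomp Require Import all_boot all_order all_algebra.
From mathcomp Require Import all_classical all_reals all_analysis.
Set Implicit Arguments.
Unset Strict Implicit.
Unset Printing Implicit Defensive.
Import Order.TTheory GRing.Theory Num.Theory.
Import numFieldNormedType.Exports.
Local Open Scope classical_set_scope.
Local Open Scope ring_scope.

(* A function on [0,1] is represented by a function R -> R whose values outside
   [0,1] are irrelevant: every notion below only depends on its restriction
   to [0,1]. *)
Section spaces.
Context {R : realType}.
Implicit Types (f y z : R -> R) (x : R).

Definition I01 : set R := `[0, 1]%classic.

Definition quot01 f x : R -> R :=
  fun w => (f w - f x) / (w - x).

(* Differentiability at x relative to [0,1]: one-sided at 0 and at 1. *)
Definition derivable01 f x : Prop :=
  cvg (quot01 f x w @[w --> within I01 x^']).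

(* Total operator; by convention 0 at the points of [0,1] where f is not
   differentiable. *)
Definition deriv01 f : R -> R :=
  fun x => lim (quot01 f x w @[w --> within I01 x^']).

Definition derivn01 (i : nat) f : R -> R := iter i deriv01 f.

Definition abs_continuous01 f : Prop :=
  forall e : R, 0 < e -> exists2 d : R, 0 < d &
    forall (n : nat) (a b : 'I_n -> R),
      (forall i, 0 <= a i /\ a i <= b i /\ b i <= 1) ->
      trivIset setT (fun i => `]a i, b i[%classic) ->
      \sum_(i < n) (b i - a i) < d ->
      \sum_(i < n) `|f (b i) - f (a i)| < e.

Definition L2_01 f : Prop :=
  (f \_ I01) \in Lfun (@lebesgue_measure R) 2%:E.

Definition W21 f : Prop := abs_continuous01 f /\ L2_01 (deriv01 f).

Definition inner1 y z : R :=
  y 0 * z 0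
  + \int[@lebesgue_measure R]_(v in I01) (deriv01 y v * deriv01 z v).

Definition W24 y : Prop :=
  [/\ forall i x, (i < 3)%N -> I01 x -> derivable01 (derivn01 i y) x,
      forall i, (i < 4)%N -> abs_continuous01 (derivn01 i y),
      L2_01 (derivn01 4 y)
    & forall i, (i < 3)%N -> derivn01 i y 0 = derivn01 i y 1].

Definition inner4 y z : R :=
  \sum_(i < 4) derivn01 i y 0 * derivn01 i z 0
  + \int[@lebesgue_measure R]_(v in I01) (derivn01 4 y v * derivn01 4 z v).

Definition norm4 y : R := Num.sqrt (inner4 y y).

Definition opT y : R -> R := derivn01 3 y.

Definition is_adjoint_opT (Tadj : (R -> R) -> (R -> R)) : Prop :=
  (forall z, W21 z -> W24 (Tadj z)) /\
  (forall y z, W24 y -> W21 z -> inner1 (opT y) z = inner4 y (Tadj z)).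

(* Reproducing kernel of W21. *)
Definition kerQ (s : R) : R -> R := fun x => if x <= s then 1 + x else 1 + s.

Fixpoint gram_schmidt_seq (v : nat -> R -> R) (n : nat) : seq (R -> R) :=
  if n is m.+1 then
    let s := gram_schmidt_seq v m in
    let u := fun x => v m x - \sum_(e <- s) inner4 (v m) e * e x in
    rcons s (fun x => (norm4 u)^-1 * u x)
  else [::].

Definition gram_schmidt (v : nat -> R -> R) (i : nat) : R -> R :=
  nth (fun=> 0) (gram_schmidt_seq v i.+1) i.

End spaces.

(* Main.v *)
Require Import Defs.
From HB Require Import structures.
From mathcomp Require Import all_boot all_order all_algebra.
From mathcomp Require Import all_classical all_reals all_analysis.
From mathcomp Require Import measurable_realfun.
From mathcomp Require Import ring lra zify.
Import Order.TTheory GRing.Theory Num.Theory.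
Import numFieldNormedType.Exports.
Local Open Scope classical_set_scope.
Local Open Scope ring_scope.
Set Implicit Arguments.
Unset Strict Implicit.
Unset Printing Implicit Defensive.

(** The adjoint relation and the reproducing property of the kernel give
    <y, psi_k> = y'''(t_k) for periodic y.  The psi_k are linearly independent,
    because polynomials provide periodic w with w'''(t_k) = 0 for k < n and
    w'''(t_n) <> 0; hence the Gram-Schmidt system is orthonormal and
    beta_ii <> 0.  Then |y_n|^2 = A_1^2 + ... + A_n^2 is bounded, so (y_n) is
    Cauchy and has a limit y with <y, psibar_i> = A_i; by induction on k, this
    triangular system says y'''(t_k) = F(t_k, y_{k-1}(t_k), ...).  Every x is a
    limit of points t_k with k -> oo, and y_n, y_n', y_n'' converge uniformly,
    so the equation holds at x.

    The inner product is handled through the fundamental theorem of calculus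
    for absolutely continuous f.  The total variation V of f is again
    absolutely continuous, and V and V - f are nondecreasing, so their
    Lebesgue-Stieltjes measures are dominated by Lebesgue measure; by
    Radon-Nikodym, f is the primitive of an integrable function, which is f'
    almost everywhere by Lebesgue differentiation. *)

(** * Absolute continuity along chains of intervals *)

(** Since [deriv01] is total with a default value, and the third derivative of an element of the
    space is only absolutely continuous, the fourth derivative is linear only almost everywhere.
    Every computation with the inner product is thus an equality of integrals up to null sets, and
    derivatives of absolutely continuous functions must be shown measurable before anything else can
    be done with them.

    Periodicity of w, w' and w'' says that w', w'' and w''' have mean zero on [0,1]. Integration
    constants take care of w' and w'', so w''' obeys a single linear condition. The test functions
    meet it by combining two polynomials that vanish at the earlier points, only one of which
    vanishes at the new point.

    Convergence of (y_n) and the values y'''(t_k) do not depend on how the numbers F(t_k, ...)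
    arise. The recursion matters only in the passage to the limit: the number at t_k involves
    y_{k-1}, which is close to y for large k only, so a fixed x has to be approached by points of
    arbitrarily large index. *)

Section clamp01.
Context {R : realType}.
Implicit Types x y : R.

(** Composition with this retraction forgets the irrelevant values of a function outside [0,1]. It
    extends monotonicity or continuity from [0,1] to the whole line, as Stieltjes measures and
    measurability arguments ask. *)
Definition clamp01 x : R := Num.max 0 (Num.min x 1).

Lemma clamp01_itv x : 0 <= clamp01 x <= 1.
Proof. by rewrite /clamp01 le_max lexx/= ge_max ler01 ge_min lexx orbT. Qed.

Lemma clamp01_le x y : x <= y -> clamp01 x <= clamp01 y.
Proof.
rewrite /clamp01 /Num.max /Num.min => xy.
by case: ifPn; case: ifPn; case: ifPn; case: ifPn; rewrite -?leNgt; lra.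
Qed.

Lemma clamp01_lip x y : x <= y -> clamp01 y - clamp01 x <= y - x.
Proof.
rewrite /clamp01 /Num.max /Num.min => xy.
by case: ifPn; case: ifPn; case: ifPn; case: ifPn; rewrite -?leNgt; lra.
Qed.

Lemma clamp01_id x : 0 <= x -> x <= 1 -> clamp01 x = x.
Proof. by move=> x0 x1; rewrite /clamp01 min_l// max_r. Qed.

End clamp01.

Section chains.
Context {R : realType}.
Implicit Types (f : R -> R) (a b : R) (s : seq (R * R)).

(* s lists non-overlapping intervals [p.1, p.2] between a and b, from left to
   right. *)
Fixpoint chain a s b : bool :=
  if s is p :: s' then [&& a <= p.1, p.1 <= p.2 & chain p.2 s' b] else a <= b.

Definition chain_len s : R := \sum_(p <- s) (p.2 - p.1).

Definition chain_var f s : R := \sum_(p <- s) `|f p.2 - f p.1|.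

(** Ordered lists replace indexed families so that an interval can be refined by concatenation. The
    bound is [<= e] because it must survive the suprema that define the total variation. *)
Definition chain_ac f := forall e : R, 0 < e -> exists2 d : R, 0 < d &
  forall s, chain 0 s 1 -> chain_len s < d -> chain_var f s <= e.

Lemma chain_le a s b : chain a s b -> a <= b.
Proof.
elim: s a => //= p s ih a /and3P[ap pp /ih].
by move/(le_trans pp); exact: le_trans.
Qed.

Lemma chain_le_start a a' s b : a <= a' -> chain a' s b -> chain a s b.
Proof.
by case: s => /= [|p s] aa'; [exact: le_trans|case/and3P =>
  /(le_trans aa') -> ->].
Qed.

Lemma chain_cat a b c s s' : chain a s b -> chain b s' c -> chain a (s ++ s') c.
Proof.
elim: s a => [|p s ih] a /=; first exact: chain_le_start.
by move=> /and3P[-> -> /ih]; apply.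
Qed.

Lemma chain_refine a b (p : R * R) s1 s s2 : chain a (s1 ++ p :: s2) b ->
  chain p.1 s p.2 -> chain a (s1 ++ s ++ s2) b.
Proof.
move=> + ps; elim: s1 a => [|q s1 ih] a /=.
  move=> /and3P[ap _ pb]; apply: chain_cat pb.
  exact: chain_le_start ps.
by move=> /and3P[-> -> /ih].
Qed.

Lemma chain_nth_ge a b s x0 i : chain a s b -> (i < size s)%N ->
  [/\ a <= (nth x0 s i).1, (nth x0 s i).1 <= (nth x0 s i).2 &
     (nth x0 s i).2 <= b].
Proof.
elim: s a i => // p s ih a [|i] /= /and3P[ap pp sb].
  by move=> _; split => //; exact: chain_le sb.
by rewrite ltnS => /(ih _ _ sb)[pi1 i12 i2]; split => //;
  rewrite (le_trans ap)// (le_trans pp).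
Qed.

Lemma chain_nth_sep a b s x0 i j : chain a s b -> (i < j < size s)%N ->
  (nth x0 s i).2 <= (nth x0 s j).1.
Proof.
elim: s a i j => [a i j|p s ih a i [|j]]; rewrite ?andbF//= => /and3P[ap pp sb].
case: i => [|i] /=; first by rewrite ltnS => /(chain_nth_ge x0 sb)[].
by rewrite !ltnS; exact: ih sb.
Qed.

Lemma ac01_chain f : abs_continuous01 f -> chain_ac f.
Proof.
move=> acf e e0; have [d d0 fd] := acf e e0; exists d => // s s01 sd.
pose a (i : 'I_(size s)) := (nth (0, 0) s i).1.
pose b (i : 'I_(size s)) := (nth (0, 0) s i).2.
have := fd (size s) a b; rewrite /chain_var (big_nth (0, 0)) big_mkord => h.
apply/ltW/h => [i|i j _ _ [x []]|].
- by have [] := chain_nth_ge (0, 0) s01 (ltn_ord i).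
- rewrite /= !in_itv/= => /andP[aix xbi] /andP[ajx xbj].
  have sep k l : (k < l < size s)%N -> x < (nth (0, 0) s k).2 ->
    (nth (0, 0) s l).1 < x -> False.
    move=> kl xk lx; have := chain_nth_sep (0, 0) s01 kl.
    by rewrite leNgt (lt_trans lx xk).
  apply/val_inj => /=; case: (ltngtP i j) => // ij.
    by case: (sep i j) => //; rewrite ij/=.
  by case: (sep j i) => //; rewrite ij/=.
- by move: sd; rewrite /chain_len (big_nth (0, 0)) big_mkord.
Qed.

Lemma chain_len_cat s s' : chain_len (s ++ s') = chain_len s + chain_len s'.
Proof. exact: big_cat. Qed.

Lemma chain_var_cat f s s' : chain_var f (s ++ s') =
  chain_var f s + chain_var f s'.
Proof. exact: big_cat. Qed.

Lemma partition_chain f a b (l : seq R) : itv_partition a b l ->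
  exists s, [/\ chain a s b, chain_len s = b - a & chain_var f s =
    variation a b f l].
Proof.
move=> abl; rewrite variation_zip//; elim: l a abl => [|x l ih] a abl.
  exists [::]; rewrite /chain_len /chain_var !big_nil /= (itv_partition_nil
    abl).
  by split => //; rewrite subrr.
have [s [sxb len_s var_s]] := ih _ (itv_partition_cons abl).
exists ((a, x) :: s); split => /=.
- by rewrite lexx/= sxb andbT; case: abl => /= /andP[/ltW].
- by rewrite /chain_len big_cons -/(chain_len s) len_s /=; ring.
- by rewrite /chain_var [LHS]big_cons [RHS]big_cons /= -var_s.
Qed.

(* Induction on s: the total variation over the head interval is a supremum
   over partitions, and each of them can be appended to s0. *)
Lemma chain_total_variation f e d :
  (forall s, chain 0 s 1 -> chain_len s < d -> chain_var f s <= e) ->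
  forall s s0, chain 0 (s0 ++ s) 1 -> chain_len (s0 ++ s) < d ->
  ((chain_var f s0)%:E + \sum_(p <- s) total_variation p.1 p.2 f <= e%:E)%E.
Proof.
move=> fed; elim => [s0|[a b] s ih s0].
  by rewrite cats0 big_nil adde0 lee_fin; exact: fed.
rewrite big_cons/= => s01 s0d.
have [abl Slen] : a <= b /\ chain_len ((a, b) :: s) = (b - a) + chain_len s.
  split; last by rewrite /chain_len big_cons.
  move: s01; clear; elim: s0 0 => [x /= /and3P[]//|p s0 ih x /= /and3P[_ _]].
  exact: ih.
have tv0 : (0 <= \sum_(p <- s) total_variation p.1 p.2 f)%E.
  have : all (fun p => p.1 <= p.2) s.
    move: s01; clear; elim: s0 0 => [x /= /and3P[_ _]|p s0 ih x /= /and3P[_ _]];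
      last exact: ih.
    by elim: s b => // p s ih b /= /and3P[_ -> /ih].
  by rewrite big_seq => /allP h; apply: sume_ge0 => p /h;
    exact: total_variation_ge0.
have H (l : seq R) : itv_partition a b l ->
    ((chain_var f s0)%:E + ((variation a b f l)%:E + \sum_(p <- s)
      total_variation p.1 p.2 f) <= e%:E)%E.
  move=> /(partition_chain f)[q [abq qlen <-]].
  have := ih (s0 ++ q); rewrite -catA chain_var_cat EFinD -addeA; apply.
    exact: chain_refine s01 abq.
  by move: s0d; rewrite !chain_len_cat Slen qlen.
have [eab|ab] := eqVneq a b.
  subst a; rewrite total_variationxx add0e.
  have := ih (s0 ++ [:: (b, b)]); rewrite -catA chain_var_cat {2}/chain_var.
  rewrite big_seq1 /= subrr normr0 addr0; apply.
    exact: s01.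
  exact: s0d.
have {}ab : a < b by rewrite lt_neqAle ab.
(* The trivial partition of [a, b] already shows that the tail is finite; it can then be moved
   across the inequality before the supremum over partitions is taken. *)
have tvfin : \sum_(p <- s) total_variation p.1 p.2 f \is a fin_num.
  rewrite ge0_fin_numE// ltey; apply/eqP => tvy.
  by have := H _ (itv_partition1 ab); rewrite tvy.
rewrite addeCA -leeBrDr ?fin_numD ?tvfin//.
apply: ge_ereal_sup => _ [_ [l Pl <-] <-].
by rewrite leeBrDr ?fin_numD ?tvfin// addeCA; exact: H.
Qed.

End chains.

(** * Total variation of an absolutely continuous function *)

Section split.
Context {R : realType}.
Implicit Types (f : R -> R).

(** [0,1] is cut into [N] intervals shorter than the [d] that belongs to [e = 1]. Each carries
    variation at most 1, so the total is at most [N]. *)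
Lemma chain_ac_total_variation_fin f : chain_ac f ->
  total_variation 0 1 f \is a fin_num.
Proof.
move=> /(_ 1 ltr01)[d d0 fd].
pose N := (Num.truncn d^-1).+1.
have Nd : N%:R^-1 < d.
  by rewrite invf_plt ?posrE// truncnS_gt.
have tvS (k : nat) : (k <= N)%N -> (total_variation 0 (k%:R / N%:R) f <=
  k%:R%:E)%E.
  elim: k => [_|k ih kN]; first by rewrite mul0r total_variationxx.
  have kk : k%:R / N%:R <= k.+1%:R / N%:R :> R.
    by rewrite ler_pM2r ?invr_gt0// ler_nat.
  have k0 : 0 <= k%:R / N%:R :> R by rewrite divr_ge0.
  rewrite (total_variationD f k0 kk) -[in leRHS]natr1 EFinD leeD//.
    exact/ih/ltnW.
  have := chain_total_variation fd (s := [:: (k%:R / N%:R,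
    k.+1%:R / N%:R)]) (s0 := [::]).
  rewrite big_seq1 /chain_var big_nil add0e; apply => /=.
    by rewrite k0 kk/= ler_pdivrMr// mul1r ler_nat.
  by rewrite /chain_len big_seq1/= -mulrBl -natrB// subSnn mul1r.
have := tvS N (leqnn _); rewrite divff ?pnatr_eq0// => tvN.
rewrite ge0_fin_numE ?total_variation_ge0//.
by apply: le_lt_trans tvN _; rewrite ltry.
Qed.

(** [V x] is the total variation on [0, x], so that increments of [V] are total variations. Its
    absolute continuity is [chain_total_variation] with [s0] empty. *)
Lemma chain_ac_dominated f : chain_ac f -> exists V : R -> R, chain_ac V /\
  forall x y, 0 <= x -> x <= y -> y <= 1 -> `|f y - f x| <= V y - V x.
Proof.
move=> acf; have tvf := chain_ac_total_variation_fin acf.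
pose V x := fine (total_variation 0 x f).
have tv_fin x y : 0 <= x -> x <= y -> y <= 1 ->
    total_variation x y f \is a fin_num.
  move=> x0 xy y1; rewrite ge0_fin_numE ?total_variation_ge0//.
  move: tvf; rewrite (total_variationD f (le_trans x0 xy) y1).
  rewrite (total_variationD f x0 xy) !fin_numD => /andP[/andP[_]].
  by rewrite ge0_fin_numE ?total_variation_ge0.
have VE x y : 0 <= x -> x <= y -> y <= 1 ->
    (V y - V x)%:E = total_variation x y f.
  move=> x0 xy y1; rewrite EFinB !fineK ?tv_fin//; last 2 first.
    exact: le_trans xy _.
    exact: le_trans x0 _.
  rewrite (total_variationD f x0 xy) addeAC subee ?add0e// tv_fin//.
  exact: le_trans xy _.
exists V; split; last first.
  by move=> x y x0 xy y1; rewrite -lee_fin VE//; exact: total_variation_ge.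
move=> e e0; have [d d0 fd] := acf e e0; exists d => // s s01 sd.
have := chain_total_variation fd (s0 := [::]) s01 sd.
rewrite /chain_var big_nil add0e => tv_le; rewrite -lee_fin;
  apply: le_trans tv_le.
have : all (fun p => [&& 0 <= p.1, p.1 <= p.2 & p.2 <= 1]) s.
  apply/(all_nthP (0, 0)) => i si.
  by have [-> -> ->] := chain_nth_ge (0, 0) s01 si.
rewrite -sumEFin !big_seq => /allP h.
apply: lee_sum => p /h /and3P[p0 pp p1]; rewrite -(VE _ _ p0 pp p1) lee_fin.
rewrite ger0_norm// subr_ge0 -subr_ge0.
by rewrite -lee_fin VE// total_variation_ge0.
Qed.

Lemma chain_ac_sub f g : chain_ac f -> chain_ac g -> chain_ac (f \- g).
Proof.
move=> acf acg e e0; have e20 : 0 < e / 2 by rewrite divr_gt0.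
have [d d0 fd] := acf _ e20; have [d' d'0 gd] := acg _ e20.
exists (Num.min d d') => [|s s01]; first by rewrite lt_min d0.
rewrite lt_min => /andP[sd sd'].
rewrite [e]splitr (le_trans _ (lerD (fd s s01 sd) (gd s s01 sd')))//.
rewrite /chain_var -big_split/=; apply: ler_sum => p _.
have -> : (f \- g) p.2 - (f \- g) p.1 = (f p.2 - f p.1) - (g p.2 - g p.1).
  by rewrite /=; ring.
exact: ler_normB.
Qed.

End split.

(** * Densities of absolutely continuous functions *)

Section null_sets.
Context {R : realType}.
Implicit Types (f G : R -> R).
Notation lam := (@lebesgue_measure R).

Section grid.
Variables (U : set R) (N : nat).

Let cell (k : nat) : set R := `](k%:R / N.+1%:R), (k.+1%:R / N.+1%:R)]%classic.

(** A cell not contained in [U] is collapsed to an empty interval instead of being deleted, so the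
    list of cells is a chain of fixed length whatever [U] is. *)
Definition grid_right (k : nat) : R :=
  (if `[< cell k `<=` U >] then k.+1%:R else k%:R) / N.+1%:R.

Definition grid_cell (k : nat) : set R :=
  `](k%:R / N.+1%:R), (grid_right k)]%classic.

Definition grid_chain := [seq (k%:R / N.+1%:R : R,
  grid_right k) | k <- iota 0 N.+1].

Lemma grid_right_ge (k : nat) :
  (k%:R / N.+1%:R <= grid_right k <= k.+1%:R / N.+1%:R).
Proof.
by rewrite /grid_right; case: ifP => _; rewrite !ler_pM2r ?invr_gt0// !ler_nat
  ?leqnn leqnSn.
Qed.

Lemma grid_chainP : chain 0 grid_chain 1.
Proof.
rewrite /grid_chain; have : forall n m, chain (m%:R / N.+1%:R)
    [seq (k%:R / N.+1%:R : R, grid_right k) | k <- iota m n] ((m + n)%:R /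
      N.+1%:R).
  elim => [m|n ih m] /=; first by rewrite addn0.
  have /andP[-> r] := grid_right_ge m; rewrite lexx/=.
  by rewrite -addSnnS; exact: chain_le_start (ih _).
by move=> /(_ N.+1 0); rewrite mul0r add0n divff// pnatr_eq0.
Qed.

Lemma grid_cell_sub (k : nat) : grid_cell k `<=` U.
Proof.
rewrite /grid_cell /grid_right; case: asboolP => // _.
by rewrite set_itvoc0.
Qed.

Lemma grid_cell_eq (k : nat) (x : R) : cell k `<=` U -> cell k x ->
  grid_cell k x.
Proof. by move=> kU; rewrite /grid_cell /grid_right; case: asboolP. Qed.

Lemma grid_cell_trivIset : trivIset setT grid_cell.
Proof.
apply: ltn_trivIset => n m mn; apply/seteqP; split => // x [].
rewrite /grid_cell /= !in_itv/= => /andP[_ xm] /andP[nx _].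
have /andP[_ mr] := grid_right_ge m.
have := lt_le_trans nx (le_trans xm mr).
by rewrite ltr_pM2r ?invr_gt0// ltr_nat ltnS leqNgt mn.
Qed.

End grid.

Variables (G : R -> R) (acG : chain_ac G).
Variable nu : {measure set (measurableTypeR R) -> \bar R}.
Hypothesis nuE : forall a b, 0 <= a -> a <= b -> b <= 1 ->
  nu `]a, b]%classic = (G b - G a)%:E.

(* U is exhausted from inside by the cells of mesh 1 / n.+1 that it contains. *)
Lemma chain_ac_measure_open (e : R) : 0 < e -> exists2 d : R, 0 < d &
  forall U : set R, open U -> (lam U < d%:E)%E ->
    (nu (U `&` `]0%R, 1%R]) <= e%:E)%E.
Proof.
move=> e0; have [d d0 Gd] := acG e0; exists d => // U oU Ud.
pose X n : set R := \big[setU/set0]_(k < n.+1) grid_cell U n k.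
have mcell n k : measurable (grid_cell U n k) by exact: measurable_itv.
have mX n : measurable (X n) by apply: bigsetU_measurable.
have XE n : X n = \bigcup_(k < n.+1) grid_cell U n k by rewrite bigcup_mkord.
have XU n : X n `<=` U.
  by rewrite XE; apply: bigcup_sub => k _; exact: grid_cell_sub.
have nuX n : (nu (X n) <= e%:E)%E.
  have lamE k : lam (grid_cell U n k) = (grid_right U n k - k%:R / n.+1%:R)%:E.
    have /andP[r _] := grid_right_ge U n k.
    rewrite lebesgue_measure_itv/= lte_fin; case: ltP => // r'.
    have -> : grid_right U n k = k%:R / n.+1%:R by apply/eqP;
      rewrite eq_le r r'.
    by rewrite subrr.
  have nuE' k : (k < n.+1)%N -> nu (grid_cell U n k) =
    (G (grid_right U n k) - G (k%:R / n.+1%:R))%:E.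
    move=> kn; have /andP[r r1] := grid_right_ge U n k; rewrite nuE//.
    rewrite (le_trans r1)// ler_pdivrMr// mul1r ler_nat//.
  have chain_iota : iota 0 n.+1 = index_iota 0 n.+1 by rewrite /index_iota
    subn0.
  have lenE : (chain_len (grid_chain U n))%:E = lam (X n).
    rewrite /X measure_bigsetU; [|exact: mcell|exact: grid_cell_trivIset].
    rewrite /chain_len big_map -sumEFin chain_iota big_mkord.
    by apply: eq_bigr => k _; exact/esym/lamE.
  have len_d : chain_len (grid_chain U n) < d.
    rewrite -lte_fin lenE; apply: (le_lt_trans _ Ud); apply: le_measure.
    - by rewrite inE; exact: mX.
    - by rewrite inE; exact: open_measurable.
    - exact: XU.
  have := Gd _ (grid_chainP U n) len_d; rewrite -lee_fin; apply: le_trans.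
  rewrite measure_bigsetU; [|exact: mcell|exact: grid_cell_trivIset].
  rewrite /chain_var big_map -sumEFin chain_iota big_mkord.
  by apply: lee_sum => k _; rewrite [leLHS](nuE' _ (ltn_ord k)) lee_fin
    ler_norm.
(* The grids are not nested, so [X] need not be monotone. The intersections of its tails are
   increasing, and [W m] inherits the bound of [X m]. *)
pose W m : set R := \bigcap_(n in [set n | (m <= n)%N]) X n.
have mW m : measurable (W m).
  by apply: bigcap_measurable => [|n _]; [exists m => /=|exact: mX].
have mWU : measurable (\bigcup_m W m) by exact: bigcup_measurable.
have Wcvg : nu \o W @ \oo --> nu (\bigcup_m W m).
  apply: nondecreasing_cvg_mu => // m n mn; apply/subsetPset => x xm k /= nk.
  by apply: xm => /=; exact: leq_trans nk.
apply: (@le_trans _ _ (nu (\bigcup_m W m))).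
  rewrite le_measure ?inE//.
    by apply: measurableI; [exact: open_measurable|exact: measurable_itv].
  move=> x [Ux]; rewrite /= in_itv/= => /andP[x0 x1].
  have /nbhs_ballP[r r0 rU] := open_nbhs_nbhs (conj oU Ux).
  exists (Num.truncn r^-1) => // n /= rn.
  have n_r : n.+1%:R^-1 < r.
    by rewrite invf_plt ?posrE// (lt_le_trans (truncnS_gt _))// ler_nat ltnS.
  (* Cells are open on the left, so the one holding [x] ends at the least multiple of the mesh that
     is not below [x]; [0 < x] excludes the multiple 0. *)
  have : exists m : nat, x * n.+1%:R <= m%:R by exists n.+1; rewrite ler_piMl.
  case/ex_minnP => -[|k] xk kmin.
    by move: xk; rewrite leNgt mulr_gt0.
  have kx : k%:R < x * n.+1%:R.
    by rewrite ltNge; apply/negP => /kmin; rewrite ltnn.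
  have kn : (k < n.+1)%N by apply: kmin; rewrite ler_piMl.
  suff : X n x by []; rewrite XE; exists k => //;
    apply: grid_cell_eq => [y|] /=;
    rewrite in_itv/= ltr_pdivrMr// ler_pdivlMr//; last by rewrite kx.
  move=> /andP[ky yk]; apply: rU; apply: le_lt_trans n_r => /=.
  rewrite -div1r ler_pdivlMr// -[X in _ * X]ger0_norm// -normrM ler_norml.
  move: xk yk; rewrite -natr1 => xk yk; apply/andP; split; lra.
rewrite -(cvg_lim _ Wcvg)//; apply: lime_le; first by apply/cvg_ex; eexists;
  exact: Wcvg.
apply: nearW => m /=; apply: le_trans (nuX m).
apply: le_measure; [by rewrite inE; exact: mW|by rewrite inE; exact: mX|].
by move=> x; apply => /=.
Qed.

(** By outer regularity a null set lies in open sets of arbitrarily small Lebesgue measure, and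
    [chain_ac_measure_open] bounds [nu] on those. *)
Lemma chain_ac_measure_null (A : set R) : measurable A -> lam A = 0%E ->
  nu (A `&` `]0%R, 1%R]) = 0%E.
Proof.
move=> mA A0; apply/eqP; rewrite eq_le measure_ge0 andbT.
apply/lee_addgt0Pr => e e0; rewrite add0e.
have [d d0 Ud] := chain_ac_measure_open e0.
have Ay : (lam A < +oo)%E by rewrite A0 ltry.
have [U [oU AU UA]] := lebesgue_regularity_outer mA Ay d0.
have mU := open_measurable oU.
have mI : measurable (`]0, 1]%classic : set R) by exact: measurable_itv.
have Ule : (lam U <= lam (U `\` A))%E.
  rewrite -[leRHS]add0e -A0 -{1}(setDUK AU); apply: measureU2 => //;
    exact: measurableD.
apply: le_trans (Ud U oU _).
  apply: le_measure; rewrite ?inE.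
  - exact: measurableI.
  - exact: measurableI.
  - exact: setSI.
exact: le_lt_trans UA.
Qed.

End null_sets.

Section monotone_density.
Context {R : realType}.
Implicit Types (f G : R -> R).
Notation lam := (@lebesgue_measure R).

Lemma chain_ac_continuous G : chain_ac G -> forall e : R, 0 < e ->
  exists2 d : R, 0 < d & forall x y, 0 <= x -> x <= y -> y <= 1 -> y - x < d ->
  `|G y - G x| <= e.
Proof.
move=> acG e e0; have [d d0 Gd] := acG e e0; exists d => // x y x0 xy y1 xyd.
have := Gd [:: (x, y)]; rewrite /chain_len /chain_var !big_seq1/=; apply => //.
by rewrite x0 xy.
Qed.

Lemma monotone_chain_ac_density G :
  (forall x y, 0 <= x -> x <= y -> y <= 1 -> G x <= G y) -> chain_ac G ->
  exists2 g : R -> R, lam.-integrable setT (EFin \o g) &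
  forall x, 0 <= x -> x <= 1 -> G x = G 0 + \int[lam]_(v in `[0, x]) g v.
Proof.
move=> ndG acG; pose H x := G (clamp01 x).
have ndH : nondecreasing H.
  move=> x y xy; have /andP[x0 _] := clamp01_itv x.
  by have /andP[_ y1] := clamp01_itv y; apply: ndG => //; exact: clamp01_le.
have rcH x : H x @[x --> at_right x] --> H x.
  apply/cvgrPdist_le => e e0; have [d d0 Gd] := chain_ac_continuous acG e0.
  near=> y; rewrite distrC; apply: Gd.
  - by have /andP[] := clamp01_itv x.
  - by apply: clamp01_le; near: y; exact: nbhs_right_ge.
  - by have /andP[] := clamp01_itv y.
  - apply: (@le_lt_trans _ _ (y - x)).
      by apply: clamp01_lip; near: y; exact: nbhs_right_ge.
    by rewrite ltrBlDl; near: y; apply: nbhs_right_lt; rewrite ltrDl.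
pose Hmix := isCumulative.Build R _ R H ndH rcH.
pose Hc : cumulative R R := HB.pack H Hmix.
pose nu : {measure set (measurableTypeR R) -> \bar R} :=
  lebesgue_stieltjes_measure Hc.
have nuE a b : 0 <= a -> a <= b -> b <= 1 ->
  nu `]a, b]%classic = (G b - G a)%:E.
  move=> a0 ab b1.
  rewrite /nu /= /lebesgue_stieltjes_measure /measure_extension.
  rewrite measurable_mu_extE/=; last exact: is_ocitv.
  by rewrite wlength_itv_bnd// /= /H !clamp01_id// ?(le_trans a0)// (le_trans
    ab).
have mI : measurable (`]0, 1]%classic : set (measurableTypeR R)).
  exact: measurable_itv.
have nufin : (nu `]0%R, 1%R]%classic < +oo)%E by rewrite nuE// ltry.
(* Restricted to ]0, 1], the measure is finite, and it gives [0, x] the mass of ]0, x], which is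
   [G x - G 0]. *)
pose nuI : {finite_measure set (measurableTypeR R) -> \bar R} :=
  mfrestr (f := nu) mI nufin.
have dom : (nuI : set _ -> \bar R) `<< lam.
  apply/null_content_dominatesP => A mA A0.
  exact: (chain_ac_measure_null acG nuE).
have [g [g0 gfin intg gE]] := @radon_nikodym_sigma_finite _ _ R lam nuI dom.
exists (fine \o g).
  by rewrite (_ : EFin \o _ = g)//; apply/funext => x /=; rewrite fineK.
move=> x x0 x1; rewrite /Rintegral.
under eq_integral do rewrite fineK//.
rewrite -gE; last exact: measurable_itv.
rewrite /= /mfrestr /mrestr.
have -> : `[0, x] `&` `]0, 1] = `]0, x]%classic.
  apply/seteqP; split => y /=; rewrite !in_itv/=.
    by move=> [/andP[_ ->] /andP[-> _]].
  by move=> /andP[y0 yx]; rewrite yx y0 (ltW y0) (le_trans yx).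
by rewrite nuE//=; ring.
Unshelve. all: by end_near.
Qed.
End monotone_density.

(** * Differentiation relative to the unit interval *)

Section has_deriv01.
Context {R : realType}.
Implicit Types (f g : R -> R) (x l : R).

Lemma I01P x : I01 x <-> 0 <= x <= 1.
Proof. by rewrite /I01 /= in_itv. Qed.

(** An equation [deriv01 f x = l] does not say that the limit exists, because of the default value;
    this predicate does. *)
Definition has_deriv01 f x l := forall e : R, 0 < e -> exists2 d : R, 0 < d &
  forall w, I01 w -> w != x -> `|w - x| < d -> `|quot01 f x w - l| <= e.

(** This gives uniqueness of relative limits, also at the end points: a step of length at most 1/2,
    to the right from [x <= 1/2] and to the left otherwise, stays in [0,1]. *)
Lemma within01_proper x : I01 x -> ProperFilter (within (@I01 R) x^').
Proof.
move=> /I01P/andP[x0 x1]; apply: Build_ProperFilter => -[d /= d0 dP].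
pose h := Num.min (d / 2) 2^-1.
have h0 : 0 < h by rewrite lt_min !divr_gt0//= invr_gt0.
have hd : h < d by rewrite gt_min; apply/orP; left; rewrite ltr_pdivrMr//; lra.
have h1 : h <= 2^-1 by rewrite ge_min lexx orbT.
have [x2|x2] := leP x 2^-1.
- apply: (dP (x + h)); rewrite ?I01P /=.
  + by rewrite opprD addrA subrr sub0r normrN gtr0_norm.
  + by rewrite gt_eqF// ltrDl.
  + by apply/I01P/andP; split; lra.
- apply: (dP (x - h)); rewrite /=.
  + by rewrite opprB addrC subrK gtr0_norm.
  + by rewrite lt_eqF// ltrBlDr ltrDl.
  + by apply/I01P/andP; split; lra.
Qed.

Lemma has_deriv01P f x l :
  has_deriv01 f x l <-> quot01 f x w @[w --> within I01 x^'] --> l.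
Proof.
split=> [fl|/cvgrPdist_le fl e e0].
  apply/cvgrPdist_le => e e0; have [d d0 fd] := fl e e0.
  exists d => //= w wx wnx Iw; rewrite distrC; apply: fd => //.
  by rewrite distrC.
have [d /= d0 fd] := fl e e0; exists d => // w Iw wx wd.
by rewrite distrC; apply: fd => //=; rewrite distrC.
Qed.

Lemma has_deriv01_deriv f x l : I01 x -> has_deriv01 f x l -> deriv01 f x = l.
Proof.
by move=> Ix /has_deriv01P fl; have ? := within01_proper Ix; apply: cvg_lim.
Qed.

Lemma has_deriv01_derivable f x l : has_deriv01 f x l -> derivable01 f x.
Proof. by move=> /has_deriv01P fl; apply/cvg_ex; exists l. Qed.

Lemma derivable01_has f x : derivable01 f x -> has_deriv01 f x (deriv01 f x).
Proof. by move=> fx; apply/has_deriv01P. Qed.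

Lemma deriv01_dvg f x : ~ derivable01 f x -> deriv01 f x = point.
Proof. exact: dvgP. Qed.

Lemma eq_has_deriv01 f g x l : I01 x -> (forall w, I01 w -> f w = g w) ->
  has_deriv01 f x l -> has_deriv01 g x l.
Proof.
move=> Ix fg fl e e0; have [d d0 fd] := fl e e0; exists d => // w Iw wx wd.
by have := fd w Iw wx wd; rewrite /quot01 !fg.
Qed.

Lemma eq_deriv01 f g x : I01 x -> (forall w, I01 w -> f w = g w) ->
  deriv01 f x = deriv01 g x.
Proof.
move=> Ix fg; have gf w : I01 w -> g w = f w by move/fg.
have [fx|fx] := pselect (derivable01 f x).
  apply/esym/has_deriv01_deriv => //; apply: eq_has_deriv01 fg _ => //.
  exact: derivable01_has.
rewrite (deriv01_dvg fx) deriv01_dvg// => /derivable01_has/(eq_has_deriv01 Ix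
  gf).
by move/has_deriv01_derivable.
Qed.

Lemma has_deriv01_lin (a b : R) f g x l m : has_deriv01 f x l ->
  has_deriv01 g x m ->
  has_deriv01 (fun w => a * f w + b * g w) x (a * l + b * m).
Proof.
move=> /has_deriv01P fl /has_deriv01P gm; apply/has_deriv01P.
rewrite (_ : quot01 _ _ = (fun w => a * quot01 f x w + b * quot01 g x w)).
  by apply: cvgD; apply: cvgMr.
by apply/funext => w; rewrite /quot01; ring.
Qed.

Lemma eq_abs_continuous01 f g : (forall w, I01 w -> f w = g w) ->
  abs_continuous01 f -> abs_continuous01 g.
Proof.
move=> fg acf e e0; have [d d0 fd] := acf e e0.
exists d => // n a b ab tr ld; have := fd n a b ab tr ld.
under eq_bigr => i _.
  have [a0 [aib b1]] := ab i; rewrite !fg; first over; apply/I01P/andP; lra.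
by [].
Qed.

Lemma abs_continuous01_lin (a b : R) f g : abs_continuous01 f ->
  abs_continuous01 g ->
  abs_continuous01 (fun w => a * f w + b * g w).
Proof.
(* The summand 1 keeps [c] positive when both coefficients are 0. *)
move=> acf acg e e0; pose c := `|a| + `|b| + 1.
have c0 : 0 < c by rewrite ltr_wpDl// addr_ge0.
have ec : 0 < e / c / 2 by rewrite !divr_gt0.
have [d d0 fd] := acf _ ec; have [d' d'0 gd] := acg _ ec.
exists (Num.min d d') => [|n u v uv tr]; first by rewrite lt_min d0.
rewrite lt_min => /andP[sd sd'].
have := fd n u v uv tr sd; have := gd n u v uv tr sd'.
set Sg := \sum_(i < n) _; set Sf := \sum_(i < n) _ => Sg_lt Sf_lt.
have Sf0 : 0 <= Sf by exact: sumr_ge0.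
have Sg0 : 0 <= Sg by exact: sumr_ge0.
apply: (@le_lt_trans _ _ (`|a| * Sf + `|b| * Sg)).
  rewrite !mulr_sumr -big_split/=; apply: ler_sum => i _.
  rewrite -!normrM (le_trans _ (ler_normD _ _))// le_eqVlt; apply/orP; left;
    apply/eqP.
  by congr (`|_|); ring.
apply: (@le_lt_trans _ _ (c * Sf + c * Sg)).
  by apply: lerD; apply: ler_wpM2r => //; rewrite /c; have := normr_ge0 a;
    have := normr_ge0 b; lra.
rewrite -mulrDr mulrC -ltr_pdivlMr//; lra.
Qed.

End has_deriv01.

(** * Measurability of the total derivative *)

Section measurable_deriv01.
Context {R : realType}.
Variable f : R -> R.
Hypothesis fc : continuous (f \o clamp01).

Let q (h x : R) := (f (clamp01 (x + h)) - f (clamp01 x)) / h.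

Let q_cont h : continuous (q h).
Proof.
move=> x; apply: cvgMl; apply: cvgB; last exact: fc.
apply: (@continuous_comp _ _ _ (fun x => x + h) (f \o clamp01)); last exact: fc.
by apply: cvgD; [exact: cvg_id|exact: cvg_cst].
Qed.

(* The set G below consists of the points where the difference quotients are
   Cauchy; each C k n is closed. *)
Let C (k n : nat) : set R := \bigcap_(p in [set p : R * R |
   [/\ p.1 != 0, p.2 != 0, `|p.1| < n.+1%:R^-1 & `|p.2| < n.+1%:R^-1]])
   [set x | `|q p.1 x - q p.2 x| <= k.+1%:R^-1].

Let mC k n : measurable (C k n).
Proof.
apply: closed_measurable; apply: closed_bigI => p _.
rewrite (_ : [set x | _] = (fun x => `|q p.1 x - q p.2 x|) @^-1` [set y | y <=
  k.+1%:R^-1])//.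
apply: closed_comp; last exact: closed_le.
by move=> x _; apply: cvg_norm; apply: cvgB; exact: q_cont.
Qed.

Let G : set R := \bigcap_k \bigcup_n C k n.

Let mG : measurable G.
Proof. by apply: bigcap_measurable => [|k _];
  [exists 0|exact: bigcup_measurable]. Qed.

Let quot01q x w : 0 < x < 1 -> I01 w -> quot01 f x w = q (w - x) x.
Proof.
move=> /andP[x0 x1] /I01P/andP[w0 w1].
by rewrite /quot01 /q (addrC x) subrK !clamp01_id// ltW.
Qed.

Let G_derivable x : 0 < x < 1 -> derivable01 f x -> G x.
Proof.
move=> x01 /derivable01_has fx k _.
have k0 : 0 < k.+1%:R^-1 / 2 :> R by rewrite !divr_gt0// invr_gt0.
have [d d0 fd] := fx _ k0.
(* Increments below [m] keep [x + h] in [0,1], where [q] is the difference quotient of [f]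
   itself. *)
pose m := Num.min d (Num.min x (1 - x)).
have m0 : 0 < m by rewrite !lt_min d0; lra.
exists (Num.truncn m^-1) => // -[h h'] [/= h0 h'0 hn hn'].
have nm : (Num.truncn m^-1).+1%:R^-1 < m by rewrite invf_plt ?posrE//
  truncnS_gt.
have near_ h1 : h1 != 0 -> `|h1| < m -> `|q h1 x - deriv01 f x| <= k.+1%:R^-1 /
  2.
  move=> h10; rewrite !lt_min => /and3P[h1d h1x h1x1].
  have Iw : I01 (x + h1).
    by apply/I01P; move: h1x h1x1; rewrite !ltr_norml; lra.
  have := fd (x + h1) Iw; rewrite quot01q// (addrC x) addrK; apply => //.
  by rewrite -subr_eq0 addrK.
have H1 := near_ h h0 (lt_trans hn nm).
have H2 := near_ h' h'0 (lt_trans hn' nm).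
rewrite (_ : q h x - _ = (q h x - deriv01 f x) - (q h' x - deriv01 f x));
  last ring.
by rewrite (le_trans (ler_normB _ _))// [leRHS]splitr lerD.
Qed.

Let derivable_G x : 0 < x < 1 -> G x -> derivable01 f x.
Proof.
move=> x01 Gx; have Ix : I01 x by apply/I01P; lra.
have ? := within01_proper Ix.
apply/cauchy_cvgP/cauchy_exP => e e0.
have [n _ Cn] := Gx (Num.truncn e^-1) Logic.I.
have ke : (Num.truncn e^-1).+1%:R^-1 < e by rewrite invf_plt ?posrE//
  truncnS_gt.
(* Any fixed increment below [1 / n.+1] would do: all quotients with small increments lie within [e]
   of this one. *)
pose h0 : R := n.+2%:R^-1.
have h0n : `|h0| < n.+1%:R^-1 by rewrite gtr0_norm ?invr_gt0// ltf_pV2 ?posrE//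
  ltr_nat.
exists (q h0 x); exists n.+1%:R^-1 => /=; first by rewrite invr_gt0.
move=> w /= wx wnx Iw; rewrite quot01q//; apply: le_lt_trans ke.
apply: (Cn (h0, w - x)); split => //=; first by rewrite invr_eq0 pnatr_eq0.
  by rewrite subr_eq0.
by rewrite distrC.
Qed.

(** On the open interval, [G] is exactly the set of points of differentiability. There [deriv01 f]
    is the limit of the quotients with increments [1 / n.+1], and off [G] it is the default value,
    so it is a pointwise limit of measurable functions. *)
Lemma measurable_deriv01 : measurable_fun I01 (deriv01 f).
Proof.
apply: (@measurable_fun_itv_cc _ _ _ false true).
pose u (n : nat) x := \1_G x * q n.+1%:R^-1 x + \1_(~` G) x * (point : R).
apply: (@measurable_fun_cvg _ _ _ _ u) => [n|x].
  apply/measurable_funTS/measurable_funD; apply: measurable_funM.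
  - exact: measurable_indic.
  - by apply: continuous_measurable_fun; exact: q_cont.
  - by apply: measurable_indic; exact: measurableC.
  - exact: measurable_cst.
rewrite /= in_itv/= => x01; have Ix : I01 x by apply/I01P; lra.
rewrite /u !indicE in_setC; case: (boolP (x \in G)) =>
  [/set_mem Gx|/negP nG] /=.
  under eq_fun do rewrite mul1r mul0r addr0.
  have /derivable01_has fx := derivable_G x01 Gx.
  apply/cvgrPdist_le => e e0; have [d d0 fd] := fx e e0.
  have m0 : 0 < Num.min d (1 - x) by rewrite lt_min d0; lra.
  near=> n; rewrite distrC.
  have : n.+1%:R^-1 < Num.min d (1 - x).
    by near: n; exact: (near_infty_natSinv_lt (PosNum m0)).
  have : 0 < n.+1%:R^-1 :> R by rewrite invr_gt0.
  set h := n.+1%:R^-1 => h0; rewrite lt_min => /andP[hd hx].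
  have Iw : I01 (x + h) by apply/I01P; lra.
  have := fd (x + h) Iw; rewrite quot01q// (addrC x) addrK gtr0_norm//.
  by apply => //; rewrite -subr_eq0 addrK gt_eqF.
under eq_fun do rewrite mul1r mul0r add0r.
rewrite deriv01_dvg; first exact: cvg_cst.
by move=> /(G_derivable x01)/mem_set.
Unshelve. all: by end_near.
Qed.

End measurable_deriv01.

(** * The fundamental theorem of calculus for absolutely continuous functions *)

Section ftc01.
Context {R : realType}.
Implicit Types (f g : R -> R) (x c : R).
Notation lam := (@lebesgue_measure R).

Lemma measurable_I01 : measurable (@I01 R). Proof. exact: measurable_itv. Qed.

Lemma ac01_unif f : abs_continuous01 f -> forall e : R, 0 < e ->
  exists2 d : R, 0 < d & forall x y, I01 x -> I01 y -> `|y - x| < d ->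
    `|f y - f x| <= e.
Proof.
move=> /ac01_chain/chain_ac_continuous acf e e0; have [d d0 fd] := acf e e0.
exists d => // x y /I01P/andP[x0 x1] /I01P/andP[y0 y1].
have [xy|/ltW yx] := leP x y; first by rewrite ger0_norm ?subr_ge0//; exact: fd.
by rewrite distrC ger0_norm ?subr_ge0// distrC; exact: fd.
Qed.

Lemma ac01_clamp_continuous f : abs_continuous01 f -> continuous (f \o clamp01).
Proof.
move=> /ac01_unif acf x; apply/cvgrPdist_le => e e0; have [d d0 fd] := acf e e0.
exists d => //= y /= xy; apply: fd; try exact/I01P/clamp01_itv.
apply: le_lt_trans xy; have [yx|/ltW yx] := leP y x.
  by rewrite !ger0_norm ?subr_ge0// ?clamp01_lip// clamp01_le.
by rewrite distrC [leRHS]distrC !ger0_norm ?subr_ge0// ?clamp01_lip//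
  clamp01_le.
Qed.

Lemma ac01_density f : abs_continuous01 f ->
  exists2 g : R -> R, lam.-integrable setT (EFin \o g) &
  forall x, I01 x -> f x = f 0 + \int[lam]_(v in `[0, x]) g v.
Proof.
move=> /ac01_chain acf; have [V [acV fV]] := chain_ac_dominated acf.
have [|g1 ig1 Vg] := @monotone_chain_ac_density _ V _ acV.
  move=> x y x0 xy y1; rewrite -subr_ge0; apply: le_trans (fV _ _ x0 xy y1).
  exact: normr_ge0.
have [|g2 ig2 Vfg] := @monotone_chain_ac_density _ (V \- f) _ (chain_ac_sub acV
  acf).
  move=> x y x0 xy y1 /=; have := ler_norm (f y - f x).
  by move/le_trans => /(_ _ (fV _ _ x0 xy y1)); lra.
exists (g1 \- g2); first by rewrite /comp/=;
  exact: (integrableB measurableT ig1 ig2).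
move=> x /I01P/andP[x0 x1]; rewrite RintegralB//; last 2 first.
- exact: integrableS ig1.
- exact: integrableS ig2.
by have := Vfg x x0 x1; have := Vg x x0 x1; rewrite /=; lra.
Qed.

Lemma density_ae_deriv f g : lam.-integrable setT (EFin \o g) ->
  (forall x, I01 x -> f x = f 0 + \int[lam]_(v in `[0, x]) g v) ->
  {ae lam, forall x, I01 x -> has_deriv01 f x (g x)}.
Proof.
move=> ig fg.
have ig' y : lam.-integrable `[0, y] (EFin \o g) by exact: integrableS ig.
have lg : locally_integrable [set: R] g.
  by apply: open_integrable_locally => //; exact: openT.
(* [FTC1] concerns points strictly above the lower limit of integration, so 0 is discarded as a null
   set. *)
have ae0 : {ae lam, forall x : R, x != 0}.
  exists [set 0]; split; [exact: measurable_set1|exact: lebesgue_measure_set1|].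
  by move=> x /= /negP; rewrite negbK => /eqP ->.
have := FTC1 ig' lg; apply: filterS2 ae0; first exact:
  (ae_filter_ringOfSetsType lam).
move=> x xn0 Fx Ix; have /I01P/andP[x0 x1] := Ix.
have [|dF dFx] := Fx; first by rewrite lte_fin lt_neqAle eq_sym xn0.
pose F y := \int[lam]_(v in `[0, y]) g v.
apply: (@eq_has_deriv01 _ (fun y => 1 * F y + f 0 * (fun=> 1) y)) => //.
  by move=> w Iw; rewrite mul1r mulr1 addrC [RHS]fg.
have -> : g x = 1 * g x + f 0 * 0 by rewrite mul1r mulr0 addr0.
apply: has_deriv01_lin; last first.
  by move=> e e0; exists 1 => // w _ _ _; rewrite /quot01 subrr mul0r subrr
    normr0 ltW.
pose G (h : R) : R := h^-1 * (F (h + x) - F x).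
have cG : cvg (G @ 0^').
  have -> : G = (fun h => h^-1 *: ((F \o shift x) (h *: 1) - F x)).
    by apply/funext => h; rewrite /G /= [h%:A]mulr1.
  exact: dF.
have : G @ 0^' --> g x by rewrite -dFx; exact: cG.
move=> /cvgrPdist_le dF' e e0; have [d /= d0 Fd] := dF' e e0.
exists d => // w Iw wx wd; have := Fd (w - x); rewrite /= sub0r normrN.
move=> /(_ wd); rewrite subr_eq0 => /(_ wx).
by rewrite distrC /G subrK /quot01 mulrC.
Qed.

(** The density given by [ac01_density] agrees almost everywhere with [deriv01 f]; as the latter is
    measurable, it can replace the density under every integral. *)
Lemma ac01_ftc f : abs_continuous01 f ->
  [/\ lam.-integrable I01 (EFin \o deriv01 f),
      {ae lam, forall x, I01 x -> has_deriv01 f x (deriv01 f x)} &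
      forall x, I01 x -> f x = f 0 + \int[lam]_(v in `[0, x]) deriv01 f v].
Proof.
move=> acf; have [g ig fg] := ac01_density acf.
have dfg := density_ae_deriv ig fg.
have mf := measurable_deriv01 (ac01_clamp_continuous acf).
have mg : measurable_fun [set: R] g by apply/measurable_EFinP;
  exact: measurable_int ig.
have mI := measurable_I01.
have aeg : {ae lam, forall x, I01 x -> g x = deriv01 f x}.
  apply: filterS dfg; first exact: (ae_filter_ringOfSetsType lam).
  by move=> x dfx Ix; rewrite (has_deriv01_deriv Ix (dfx Ix)).
split.
- apply/integrableP; split; first exact/measurable_EFinP.
  have /integrableP[_] : lam.-integrable I01 (EFin \o g) by exact: integrableS
    ig.
  apply: le_lt_trans; rewrite le_eqVlt; apply/orP; left; apply/eqP.
  apply: ge0_ae_eq_integral => //.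
  + by apply: measurableT_comp => //; apply/measurable_EFinP.
  + by apply: measurableT_comp => //; apply/measurable_EFinP;
    exact: measurable_funTS.
  + apply: filterS aeg; first exact: (ae_filter_ringOfSetsType lam).
    by move=> x /= gx Ix; rewrite gx.
- apply: filterS dfg; first exact: (ae_filter_ringOfSetsType lam).
  by move=> x dfx Ix; rewrite (has_deriv01_deriv Ix (dfx Ix)); exact: dfx.
- move=> x Ix; rewrite fg//; congr (_ + fine _).
  have sub : `[0, x] `<=` (@I01 R).
    move=> y /=; rewrite in_itv/= => /andP[y0 yx]; apply/I01P; rewrite y0.
    by have /I01P/andP[_] := Ix; exact: le_trans.
  apply: ae_eq_integral => //.
  + by apply/measurable_EFinP; exact: measurable_funTS.
  + by apply/measurable_EFinP; exact: measurable_funS mf.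
  + apply: filterS aeg; first exact: (ae_filter_ringOfSetsType lam).
    by move=> y gy /sub/gy /= ->.
Qed.

End ftc01.

Section bounded01.
Context {R : realType}.
Notation lam := (@lebesgue_measure R).

Lemma lebesgue_measure_I01 : lam I01 = 1%:E.
Proof. by rewrite /I01 lebesgue_measure_itv/= lte_fin ltr01 oppr0 adde0. Qed.

Lemma integrable01_bounded (D : set R) (f : R -> R) (M : R) : measurable D ->
  D `<=` I01 -> measurable_fun D f -> (forall v, D v -> `|f v| <= M) ->
  lam.-integrable D (EFin \o f).
Proof.
move=> mD DI mf fM; apply: measurable_bounded_integrable => //.
  apply: (@le_lt_trans _ _ (lam I01)); last by rewrite lebesgue_measure_I01
    ltry.
  by apply: le_measure; rewrite ?inE//; exact: measurable_I01.
exists M; split; first exact: num_real.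
by move=> y My v Dv; apply: le_trans (ltW My); exact: fM.
Qed.

End bounded01.

(** * Primitives of integrable functions *)

Section prim01.
Context {R : realType}.
Implicit Types (f g : R -> R) (x c : R).
Notation lam := (@lebesgue_measure R).

Variable g : R -> R.
Hypothesis ig : lam.-integrable I01 (EFin \o g).
Variable c : R.

Definition prim01 x : R := c + \int[lam]_(v in `[0, x]) g v.

Lemma sub_oc_I01 x y : 0 <= x -> y <= 1 -> `]x, y] `<=` (@I01 R).
Proof.
move=> x0 y1 v /=; rewrite in_itv/= => /andP[xv vy]; apply/I01P; lra.
Qed.

Lemma prim01_sub x y : 0 <= x -> x <= y -> y <= 1 ->
  prim01 y - prim01 x = \int[lam]_(v in `]x, y]) g v.
Proof.
move=> x0 xy y1; rewrite /prim01 opprD addrACA subrr add0r.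
apply: Rintegral_itvB; rewrite ?bnd_simp//.
apply: integrableS ig => //; first exact: measurable_I01.
by move=> v /=; rewrite in_itv/= => /andP[v0 vy]; apply/I01P; lra.
Qed.

Lemma prim01_0 : prim01 0 = c.
Proof. by rewrite /prim01 set_itv1 Rintegral_set1 addr0. Qed.

(** A mean value estimate: [m = g x] serves to differentiate the primitive, [m = 0] to bound its
    growth. *)
Lemma prim01_sub_le x y m e : 0 <= x -> x <= y -> y <= 1 ->
  (forall v, x < v <= y -> `|g v - m| <= e) ->
  `|prim01 y - prim01 x - m * (y - x)| <= e * (y - x).
Proof.
move=> x0 xy y1 gm; rewrite prim01_sub//.
have mxy : measurable `]x, y]%classic by exact: measurable_itv.
have lxy : lam `]x, y]%classic = (y - x)%:E.
  rewrite lebesgue_measure_itv/= lte_fin; case: ltgtP xy => // -> _.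
  by rewrite subrr.
have fin_c k : lam.-integrable `]x, y] (EFin \o cst k).
  apply: (@integrable01_bounded _ _ _ `|k|) => //.
  exact: sub_oc_I01.
have ixy : lam.-integrable `]x, y] (EFin \o g).
  by apply: integrableS ig => //; [exact: measurable_I01|exact: sub_oc_I01].
have cE k : \int[lam]_(v in `]x, y]) k = k * (y - x).
  by rewrite Rintegral_cst// [X in fine X]lxy.
have igm : lam.-integrable `]x, y] (EFin \o (fun v => g v - m)).
  exact: (integrableB _ ixy (fin_c m)).
rewrite -cE -RintegralB//; last exact: fin_c.
rewrite (le_trans (le_normr_Rintegral _ igm))//.
rewrite -cE; apply: le_Rintegral => //.
- exact: (integrable_norm igm).
- exact: (fin_c e).
Qed.

Lemma prim01_has_deriv x : I01 x ->
  (forall e : R, 0 < e -> exists2 d : R, 0 < d &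
     forall w, I01 w -> `|w - x| < d -> `|g w - g x| <= e) ->
  has_deriv01 prim01 x (g x).
Proof.
move=> /I01P/andP[x0 x1] gx e e0; have [d d0 gd] := gx e e0; exists d => // w.
move=> /I01P/andP[w0 w1] wx wd; rewrite /quot01.
have wx0 : w - x != 0 by rewrite subr_eq0.
rewrite -(mulfK wx0 (g x)) -mulrBl normrM normfV ler_pdivrMr ?normr_gt0//.
have [xw|] := leP x w.
- rewrite [X in _ <= _ * X]ger0_norm ?subr_ge0//; apply: prim01_sub_le => // v.
  move=> /andP[xv vw]; apply: gd; first by apply/I01P; lra.
  by move: wd; rewrite !ltr_norml; lra.
- move=> /ltW xw; rewrite -[leLHS]normrN -[X in _ <= _ * X]normrN.
  rewrite opprB (opprB w x) [X in _ <= _ * X]ger0_norm ?subr_ge0//.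
  rewrite (_ : g x * _ - _ = prim01 x - prim01 w - g x * (x - w)); last ring.
  apply: prim01_sub_le => // v.
  move=> /andP[xv vw]; apply: gd; first by apply/I01P; lra.
  by move: wd; rewrite !ltr_norml; lra.
Qed.

Let gI := g \_ I01.

Let igI : lam.-integrable setT (EFin \o gI).
Proof.
have mI : measurable (I01 : set (measurableTypeR R)) by exact: measurable_I01.
by have := (integrable_mkcond _ mI).1 ig; rewrite restrict_EFin.
Qed.

(** The integral of [|g|] over a set is small when the measure of the set is; here the set is the
    union of the intervals, and its measure is the sum of their lengths. *)
Lemma prim01_abs_continuous : abs_continuous01 prim01.
Proof.
move=> e e0; have [d [d0 gd]] := integral_normr_continuous igI e0.
exists d => // n a b ab tr lend.
pose J (i : 'I_n) : set (measurableTypeR R) := `]a i, b i[%classic.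
have mJ i : measurable (J i) by exact: measurable_itv.
have lamJ i : lam (J i) = (b i - a i)%:E.
  have [_ [aib _]] := ab i.
  rewrite lebesgue_measure_itv/= lte_fin; case: ltgtP aib => // -> _.
  by rewrite subrr.
have mU : measurable (\big[setU/set0]_(i < n) J i) by apply: bigsetU_measurable.
have lamU : lam (\big[setU/set0]_(i < n) J i) = (\sum_(i < n) (b i - a i))%:E.
  rewrite measure_semi_additive_ord//.
  by rewrite -sumEFin; apply: eq_bigr => i _; exact: lamJ.
have ltd : (lam (\big[setU/set0]_(i < n) J i) < d%:E)%E by rewrite lamU lte_fin.
apply: le_lt_trans (gd _ mU ltd).
rewrite -lee_fin.
have mgI : measurable_fun [set: R] gI.
  by apply/measurable_EFinP; exact: (measurable_int lam igI).
have inI i : `]a i, b i] `<=` (@I01 R).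
  by have [a0 [_ b1]] := ab i; exact: sub_oc_I01.
have ioc i : lam.-integrable `]a i, b i] (EFin \o gI) by exact: integrableS igI.
have iU : lam.-integrable (\big[setU/set0]_(i < n) J i) (EFin \o (Num.norm \o
  gI)).
  by apply: integrable_norm; exact: integrableS igI.
rewrite [leRHS]fineK; last exact: (integrable_fin_num _ iU).
rewrite integral_bigsetU_EFin//=; last 3 first.
- exact: index_enum_uniq.
- by apply: sub_trivIset tr.
- exact/measurable_EFinP/measurable_funTS/measurableT_comp.
rewrite -sumEFin; apply: lee_sum => i _.
have [a0 [aib b1]] := ab i.
rewrite prim01_sub//.
have iJ : lam.-integrable (J i) (EFin \o (Num.norm \o gI)).
  by apply: integrable_norm; exact: integrableS igI.
rewrite -[leRHS]fineK; last exact: (integrable_fin_num _ iJ).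
rewrite lee_fin -[leRHS]/(\int[lam]_(v in J i) `|gI v|).
(* Disjointness is assumed for open intervals, while increments of the primitive are integrals over
   half-open ones; the end point has measure 0. *)
have -> : \int[lam]_(v in J i) `|gI v| = \int[lam]_(v in `]a i, b i]) `|gI v|.
  exact: (Rintegral_itv_bndo_bndc (f := Num.norm \o gI)).
rewrite (_ : \int[lam]_(v in _) g v = \int[lam]_(v in `]a i, b i]) gI v).
  exact: le_normr_Rintegral.
by apply: eq_Rintegral => v vab; rewrite /gI patchE mem_set//;
  exact/(inI i)/set_mem.
Qed.

Lemma prim01_ae_deriv : {ae lam, forall x, I01 x -> has_deriv01 prim01 x (g x)}.
Proof.
have := @density_ae_deriv _ prim01 gI igI; move=> H.
have {}H : {ae lam, forall x, I01 x -> has_deriv01 prim01 x (gI x)}.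
  apply: H => x Ix; rewrite prim01_0 /prim01; congr (_ + _).
  apply: eq_Rintegral => v; rewrite inE/= in_itv/= => /andP[v0 vx].
  rewrite /gI patchE mem_set//; apply/I01P.
  by have /I01P/andP[_ x1] := Ix; lra.
apply: filterS H; first exact: (ae_filter_ringOfSetsType lam).
by move=> x + Ix => /(_ Ix); rewrite /gI patchE mem_set.
Qed.

End prim01.

(** * Square-integrable functions on the unit interval *)

Section sqint.
Context {R : realType}.
Implicit Types (f g : R -> R) (x : R).
Notation lam := (@lebesgue_measure R).
Notation mI := (measurable_I01 : measurable (I01 : set (measurableTypeR R))).

Definition sqint01 f := measurable_fun I01 f /\
  lam.-integrable I01 (EFin \o (fun x => f x ^+ 2)).

Lemma L2_01P f : L2_01 f <-> sqint01 f.
Proof.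
have sqE : (fun x => (f \_ I01) x ^+ 2) = (fun x => f x ^+ 2) \_ I01.
  by apply/funext => x; rewrite !patchE; case: ifP => // _; rewrite expr0n.
split=> [Lf|[mf i2]].
  split.
    apply/(measurable_restrictT _ _).2; first exact: measurable_I01.
    by move: Lf; rewrite /L2_01 => /andP[]; rewrite inE.
  apply/(integrable_mkcond _ mI); rewrite restrict_EFin -sqE.
  exact: Lfun2_integrable_sqr.
have mfI : measurable_fun setT (f \_ I01).
  by apply/(measurable_restrictT _ _).1 => //; exact: measurable_I01.
rewrite /L2_01 inE; apply/andP; split; rewrite inE//=.
rewrite /finite_norm unlock; apply: poweR_lty.
have /(integrable_mkcond _ mI) := i2; rewrite restrict_EFin -sqE.
move=> /integrableP[_]; apply: le_lt_trans; rewrite le_eqVlt; apply/orP; left.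
apply/eqP; apply: eq_integral => x _ /=.
by congr EFin; rewrite powR_mulrn// normrX.
Qed.

(** The product is dominated by [f ^+ 2 + g ^+ 2]. *)
Lemma sqint01_mul f g : sqint01 f -> sqint01 g ->
  lam.-integrable I01 (EFin \o (fun x => f x * g x)).
Proof.
move=> [mf i2f] [mg i2g].
have ifg := integrableD mI i2f i2g.
apply: (le_integrable mI _ _ ifg).
  by apply/measurable_EFinP; exact: measurable_funM.
move=> x _ /=; rewrite lee_fin [leRHS]ger0_norm ?addr_ge0 ?sqr_ge0//.
by rewrite ler_norml; nra.
Qed.

Lemma sqint01_cst k : sqint01 (cst k).
Proof.
split; first exact: measurable_cst.
apply: (@integrable01_bounded _ _ _ (k ^+ 2)) => //;
  first exact: measurable_I01.
  by apply: measurable_funX; exact: measurable_cst.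
by move=> v _; rewrite ger0_norm// sqr_ge0.
Qed.

Lemma sqint01_integrable f : sqint01 f -> lam.-integrable I01 (EFin \o f).
Proof.
move=> sf; have := sqint01_mul sf (sqint01_cst 1);
  rewrite (_ : (fun _ => _) = f)//.
by apply/funext => x; rewrite mulr1.
Qed.

Lemma sqint01_lin a b f g : sqint01 f -> sqint01 g ->
  sqint01 (fun x => a * f x + b * g x).
Proof.
move=> sf sg; have [mf i2f] := sf; have [mg i2g] := sg; split.
  by apply: measurable_funD; apply: measurable_funM => //;
    exact: measurable_cst.
have ifg := sqint01_mul sf sg.
have := integrableD mI (integrableD mI (integrableZl mI (a ^+ 2) i2f)
  (integrableZl mI (b ^+ 2) i2g)) (integrableZl mI (2 * a * b) ifg).
apply: (eq_integrable mI) => x _ /=; rewrite -!EFinM -!EFinD; congr EFin; ring.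
Qed.

Lemma Rintegral01_lin a b f g : lam.-integrable I01 (EFin \o f) ->
  lam.-integrable I01 (EFin \o g) ->
  \int[lam]_(v in I01) (a * f v + b * g v) =
  a * \int[lam]_(v in I01) f v + b * \int[lam]_(v in I01) g v.
Proof.
move=> if_ ig.
have ia : lam.-integrable I01 (EFin \o (fun v => a * f v)).
  exact: (integrableZl mI a if_).
have ib : lam.-integrable I01 (EFin \o (fun v => b * g v)).
  exact: (integrableZl mI b ig).
by rewrite (RintegralD mI ia ib) (RintegralZl _ mI if_) (RintegralZl _ mI ig).
Qed.

Lemma ae_eq_Rintegral01 f g : measurable_fun I01 f -> measurable_fun I01 g ->
  {ae lam, forall x, I01 x -> f x = g x} ->
  \int[lam]_(v in I01) f v = \int[lam]_(v in I01) g v.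
Proof.
move=> mf mg fg; congr fine; apply: ae_eq_integral; first exact: mI.
- exact/measurable_EFinP.
- exact/measurable_EFinP.
- apply: filterS fg; first exact: (ae_filter_ringOfSetsType lam).
  by move=> x fx /fx /= ->.
Qed.

Lemma ae_eq_integrable01 f g : measurable_fun I01 g ->
  lam.-integrable I01 (EFin \o f) ->
  {ae lam, forall x, I01 x -> f x = g x} -> lam.-integrable I01 (EFin \o g).
Proof.
move=> mg /integrableP[mf iff] fg; apply/integrableP; split;
  first exact/measurable_EFinP.
move: iff; apply: le_lt_trans; rewrite le_eqVlt; apply/orP; left; apply/eqP.
apply: (ge0_ae_eq_integral mI) => //.
- by apply: measurableT_comp => //; apply/measurable_EFinP.
- by apply: measurableT_comp => //.
- apply: filterS fg; first exact: (ae_filter_ringOfSetsType lam).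
  by move=> x /= gx Ix; rewrite gx.
Qed.

Lemma ae_eq_sqint01 f g : measurable_fun I01 g -> sqint01 f ->
  {ae lam, forall x, I01 x -> f x = g x} -> sqint01 g.
Proof.
move=> mg [mf i2f] fg; split => //; apply: ae_eq_integrable01 i2f _.
  exact: measurable_funX.
apply: filterS fg; first exact: (ae_filter_ringOfSetsType lam).
by move=> x fx /fx ->.
Qed.

(** As [0,1] has measure 1, this is the nonnegativity of the variance of [|f|], whose mean is
    [M]. *)
Lemma sqint01_norm_le f : sqint01 f ->
  \int[lam]_(v in I01) `|f v| <= Num.sqrt (\int[lam]_(v in I01) (f v ^+ 2)).
Proof.
move=> sf; have [mf i2f] := sf.
have sn : sqint01 (fun x => `|f x|).
  split; first exact: measurableT_comp.
  apply: (eq_integrable mI) i2f => x _ /=; congr EFin.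
  by rewrite real_normK// num_real.
set M := \int[lam]_(v in I01) `|f v|.
have M0 : 0 <= M by apply: Rintegral_ge0 => x _; exact: normr_ge0.
have : 0 <= \int[lam]_(v in I01) ((`|f v| - M) ^+ 2).
  by apply: Rintegral_ge0 => x _; exact: sqr_ge0.
have -> : \int[lam]_(v in I01) ((`|f v| - M) ^+ 2) =
    \int[lam]_(v in I01) (f v ^+ 2) - M ^+ 2.
  have iM : lam.-integrable I01 (EFin \o (fun v =>
    - 2 * M * `|f v| + M ^+ 2 * (fun=> 1) v)).
    apply: sqint01_integrable; apply: sqint01_lin => //; exact: sqint01_cst.
  have -> : \int[lam]_(v in I01) ((`|f v| - M) ^+ 2) = \int[lam]_(v in I01)
     (1 * f v ^+ 2 + 1 * (- 2 * M * `|f v| + M ^+ 2 * (fun=> 1) v)).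
    apply: eq_Rintegral => v _; rewrite -[f v ^+ 2]real_normK ?num_real//; ring.
  rewrite Rintegral01_lin// Rintegral01_lin//.
  - rewrite Rintegral_cst; last exact: mI.
    have -> : fine (lam I01) = 1 by rewrite lebesgue_measure_I01.
    by rewrite -/M; ring.
  - exact: sqint01_integrable.
  - exact/sqint01_integrable/sqint01_cst.
rewrite subr_ge0 => MI.
by rewrite -[leLHS]ger0_norm// -sqrtr_sqr ler_wsqrtr.
Qed.

End sqint.

(** * The inner product of order 4 *)

Section iterated_derivative.
Context {R : realType}.
Implicit Types y : R -> R.

(* Sealed copies of derivn01, inner4 and norm4: unification of two unsealed
   iterated derivatives unfolds the nested limits and does not terminate in
   practice. *)
Definition Dn : nat -> (R -> R) -> R -> R := locked derivn01.

Lemma DnE : derivn01 = Dn. Proof. by rewrite /Dn -lock. Qed.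

Lemma Dn0 y : Dn 0 y = y. Proof. by rewrite -DnE. Qed.

Lemma DnS i y : Dn i.+1 y = deriv01 (Dn i y). Proof. by rewrite -DnE. Qed.

Definition In4 : (R -> R) -> (R -> R) -> R := locked inner4.

Lemma inner4In4 : inner4 = In4. Proof. by rewrite /In4 -lock. Qed.

Definition N4 : (R -> R) -> R := locked norm4.

Lemma norm4N4 : norm4 = N4. Proof. by rewrite /N4 -lock. Qed.

Lemma N4E y : N4 y = Num.sqrt (In4 y y).
Proof. by rewrite -norm4N4 -inner4In4. Qed.

Lemma In4E y z : In4 y z = \sum_(i < 4) Dn i y 0 * Dn i z 0
  + \int[@lebesgue_measure R]_(v in I01) (Dn 4 y v * Dn 4 z v).
Proof. by rewrite -inner4In4 /inner4 DnE. Qed.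

End iterated_derivative.

Section H4.
Context {R : realType}.
Implicit Types (f g y z w : R -> R) (x : R).
Notation lam := (@lebesgue_measure R).
Notation mI := (measurable_I01 : measurable (I01 : set (measurableTypeR R))).

(** The larger space in which the Hilbert space arguments take place. It contains all polynomials;
    periodicity is a further condition that passes to limits. *)
Definition H4 y : Prop :=
  [/\ forall i x, (i < 3)%N -> I01 x -> derivable01 (Dn i y) x,
      forall i, (i < 4)%N -> abs_continuous01 (Dn i y) &
      L2_01 (Dn 4 y)].

Lemma W24P y : W24 y <-> H4 y /\
  forall i, (i < 3)%N -> Dn i y 0 = Dn i y 1.
Proof. by rewrite /W24 DnE; split=> [[? ? ? ?]|[[? ? ?] ?]]. Qed.

Lemma I01_0 : I01 (0 : R). Proof. by apply/I01P; rewrite lexx ler01. Qed.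
Lemma I01_1 : I01 (1 : R). Proof. by apply/I01P; rewrite lexx ler01. Qed.

Lemma eq_Dn y z i x : (forall v, I01 v -> y v = z v) -> I01 x ->
  Dn i y x = Dn i z x.
Proof.
move=> yz; elim: i x => [|i ih] x Ix; first by rewrite !Dn0 yz.
by rewrite !(DnS i); exact: eq_deriv01.
Qed.

Lemma eq_In4 y y' z z' : (forall v, I01 v -> y v = y' v) ->
  (forall v, I01 v -> z v = z' v) -> In4 y z = In4 y' z'.
Proof.
move=> yy' zz'; rewrite !In4E; apply: f_equal2.
  by apply: eq_bigr => i _; rewrite !(eq_Dn _ yy' I01_0) !(eq_Dn _ zz' I01_0).
apply: eq_Rintegral => v /set_mem Iv.
by rewrite (eq_Dn 4 yy' Iv) (eq_Dn 4 zz' Iv).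
Qed.

Lemma eq_N4 y z : (forall v, I01 v -> y v = z v) -> N4 y = N4 z.
Proof. by move=> yz; rewrite !N4E (eq_In4 yz yz). Qed.

Lemma In4C y z : In4 y z = In4 z y.
Proof.
rewrite !In4E; apply: f_equal2; first by apply: eq_bigr => i _; rewrite mulrC.
by apply: eq_Rintegral => v _; exact: mulrC.
Qed.

Lemma In4_ge0 y : 0 <= In4 y y.
Proof.
rewrite !In4E addr_ge0//; first by apply: sumr_ge0 => i _; exact: sqr_ge0.
by apply: Rintegral_ge0 => v _; exact: sqr_ge0.
Qed.

Lemma N4_sqr y : N4 y ^+ 2 = In4 y y.
Proof. by rewrite N4E sqr_sqrtr// In4_ge0. Qed.

Lemma N4_ge0 y : 0 <= N4 y. Proof. by rewrite N4E sqrtr_ge0. Qed.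

Lemma H4_has_deriv y i x : H4 y -> (i < 3)%N -> I01 x ->
  has_deriv01 (Dn i y) x (Dn i.+1 y x).
Proof.
by move=> [dy _ _] i3 Ix; rewrite DnS; apply: derivable01_has; exact: dy.
Qed.

Lemma Dn_lin a b y z i x : H4 y -> H4 z -> (i < 4)%N -> I01 x ->
  Dn i (fun v => a * y v + b * z v) x =
  a * Dn i y x + b * Dn i z x.
Proof.
move=> Hy Hz; elim: i x => [|i ih] x i3 Ix; first by rewrite !Dn0.
rewrite !(DnS i); apply: has_deriv01_deriv => //.
apply: (@eq_has_deriv01 _ (fun v => a * Dn i y v + b * Dn i z v)) => //.
  by move=> v Iv; rewrite ih// ltnW.
by apply: has_deriv01_lin; rewrite -DnS; exact: H4_has_deriv.
Qed.

(** Third derivatives are differentiable only almost everywhere, and at the remaining points the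
    default value of [deriv01] may break linearity. *)
Lemma Dn4_lin a b y z : H4 y -> H4 z -> {ae lam, forall x, I01 x ->
  a * Dn 4 y x + b * Dn 4 z x =
  Dn 4 (fun v => a * y v + b * z v) x}.
Proof.
move=> Hy Hz; have [_ /(_ 3 isT)/ac01_ftc[_ ay _] _] := Hy.
have [_ /(_ 3 isT)/ac01_ftc[_ az _] _] := Hz.
apply: filterS2 ay az; first exact: (ae_filter_ringOfSetsType lam).
move=> x dy dz Ix; apply/esym; rewrite !(DnS 3).
apply: has_deriv01_deriv => //.
apply: (@eq_has_deriv01 _ (fun v => a * Dn 3 y v + b * Dn 3 z v)) => //.
  by move=> v Iv; rewrite Dn_lin.
by apply: has_deriv01_lin; [exact: dy|exact: dz].
Qed.

Lemma H4_sqint y : H4 y -> sqint01 (Dn 4 y).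
Proof. by move=> [_ _ /L2_01P]. Qed.

Lemma H4_lin a b y z : H4 y -> H4 z -> H4 (fun v => a * y v + b * z v).
Proof.
move=> Hy Hz; have [_ acy _] := Hy; have [_ acz _] := Hz.
have aci i : (i < 4)%N -> abs_continuous01 (Dn i (fun v => a * y v + b * z v)).
  move=> i4; apply: eq_abs_continuous01 (abs_continuous01_lin a b (acy i i4)
    (acz i i4)).
  by move=> w Iw; rewrite Dn_lin.
split => // [i x i3 Ix|].
  apply: has_deriv01_derivable.
  apply: (@eq_has_deriv01 _ (fun v => a * Dn i y v + b * Dn i z v)) => //.
    by move=> v Iv; rewrite Dn_lin// ltnW.
  by apply: has_deriv01_lin; exact: H4_has_deriv.
apply/L2_01P; apply: ae_eq_sqint01 (Dn4_lin a b Hy Hz).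
  by rewrite (DnS 3); apply: measurable_deriv01; apply: ac01_clamp_continuous;
    exact: (aci 3).
by apply: sqint01_lin; exact: H4_sqint.
Qed.

Lemma In4_lin a b y z w : H4 y -> H4 z -> H4 w ->
  In4 (fun v => a * y v + b * z v) w = a * In4 y w + b * In4 z w.
Proof.
move=> Hy Hz Hw.
have intE : \int[lam]_(v in I01) (Dn 4 (fun v =>
  a * y v + b * z v) v * Dn 4 w v) =
  \int[lam]_(v in I01) (a * (Dn 4 y v * Dn 4 w v) +
    b * (Dn 4 z v * Dn 4 w v)).
  have [mw _] := H4_sqint Hw; have [my _] := H4_sqint Hy;
    have [mz _] := H4_sqint Hz.
  have [ml _] := H4_sqint (H4_lin a b Hy Hz).
  apply: ae_eq_Rintegral01.
  - exact: (measurable_funM ml mw).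
  - have mc c : measurable_fun I01 (cst c : R -> R) by exact: measurable_cst.
    apply: measurable_funD.
      exact: (measurable_funM (mc a) (measurable_funM my mw)).
    exact: (measurable_funM (mc b) (measurable_funM mz mw)).
  - apply: filterS (Dn4_lin a b Hy Hz); first exact: (ae_filter_ringOfSetsType
    lam).
    move=> x lx Ix; rewrite -(lx Ix); ring.
rewrite !In4E intE.
have iyw := sqint01_mul (H4_sqint Hy) (H4_sqint Hw).
have izw := sqint01_mul (H4_sqint Hz) (H4_sqint Hw).
rewrite (Rintegral01_lin _ _ iyw izw).
rewrite !mulrDr addrACA; apply: f_equal2; last by [].
rewrite !mulr_sumr -big_split/=.
apply: eq_bigr => i _; rewrite Dn_lin//; last exact: I01_0.
ring.
Qed.

Lemma In4_linr a b y z w : H4 y -> H4 z -> H4 w ->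
  In4 w (fun v => a * y v + b * z v) = a * In4 w y + b * In4 w z.
Proof.
move=> Hy Hz Hw; rewrite In4C (In4_lin a b Hy Hz Hw).
by rewrite (In4C y) (In4C z).
Qed.

Lemma In4_cauchy y z : H4 y -> H4 z -> `|In4 y z| <= N4 y * N4 z.
Proof.
move=> Hy Hz.
have key a b : 0 <= a ^+ 2 * In4 y y + 2 * a * b * In4 y z + b ^+ 2 * In4 z z.
  have Hl := H4_lin a b Hy Hz; have := In4_ge0 (fun v => a * y v + b * z v).
  by rewrite In4_lin// !In4_linr// (In4C z y); nra.
suff : In4 y z ^+ 2 <= In4 y y * In4 z z.
  rewrite -!N4_sqr -exprMn -[In4 y z ^+ 2]real_normK ?num_real//.
  by rewrite ler_sqr// nnegrE ?mulr_ge0// N4_ge0.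
have z0 := In4_ge0 z; have y0 := In4_ge0 y.
(* If [In4 z z = 0], the coefficients below reduce the quadratic form to [- In4 y z ^+ 2], which
   forces [In4 y z = 0]. Otherwise the usual coefficients produce the discriminant. *)
have [zz|] := eqVneq (In4 z z) 0.
  rewrite zz mulr0.
  have := key (In4 y z) (- (In4 y y + 1) / 2); rewrite zz mulr0 addr0; nra.
move=> zn; have {}zn : 0 < In4 z z by rewrite lt_neqAle eq_sym zn.
have := key (In4 z z) (- In4 y z).
rewrite (_ : _ + _ = In4 z z * (In4 y y * In4 z z - In4 y z ^+ 2)); last ring.
by rewrite pmulr_rge0// subr_ge0.
Qed.

Lemma N4_Dn0 y i : (i < 4)%N -> `|Dn i y 0| <= N4 y.
Proof.
move=> i4; rewrite -ler_sqr ?nnegrE ?N4_ge0// N4_sqr real_normK ?num_real//.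
rewrite !In4E (bigD1 (Ordinal i4))//= -addrA lerDl addr_ge0//.
  by apply: sumr_ge0 => j _; exact: sqr_ge0.
by apply: Rintegral_ge0 => v _; exact: sqr_ge0.
Qed.

Lemma N4_int4 y : H4 y -> \int[lam]_(v in I01) `|Dn 4 y v| <= N4 y.
Proof.
move=> /H4_sqint/sqint01_norm_le/le_trans; apply; rewrite N4E;
  apply: ler_wsqrtr.
by rewrite !In4E lerDr; apply: sumr_ge0 => j _; exact: sqr_ge0.
Qed.

(** Downward induction on the order: the third derivative is at most its value at 0 plus the
    integral of [|Dn 4 y|], both bounded by [N4 y], and each further integration over [0,1] adds one
    value at 0. Hence convergence in norm implies uniform convergence of the derivatives up to order
    3. *)
Lemma N4_Dn y k x : H4 y -> (k < 4)%N -> I01 x ->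
  `|Dn (3 - k) y x| <= k.+2%:R * N4 y.
Proof.
move=> Hy k4; have [_ acy _] := Hy.
elim: k k4 x => [_|k ih k4] x Ix; have /I01P/andP[x0 x1] := Ix.
  have := ac01_ftc (acy 3 isT); rewrite -DnS => -[int4 _ D3E].
  rewrite subn0 D3E// mulr_natl mulr2n.
  rewrite (le_trans (ler_normD _ _))// lerD ?N4_Dn0//.
  apply: le_trans (N4_int4 Hy).
  have sub : `[0, x] `<=` (@I01 R).
    by move=> v /=; rewrite in_itv/= => /andP[v0 vx]; apply/I01P; lra.
  have intx : lam.-integrable `[0, x] (EFin \o Dn 4 y).
    by apply: integrableS int4 => //; exact: measurable_I01.
  rewrite (le_trans (le_normr_Rintegral _ intx))//.
  have nint := integrable_norm int4.
  apply: fine_le.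
  - by apply: (integrable_fin_num _ (integrable_norm intx)).
  - exact: (integrable_fin_num mI nint).
  - apply: ge0_subset_integral => //; first exact: mI.
    by case/integrableP : nint.
have k3 : (2 - k < 3)%N by rewrite ltnS leq_subr.
have [intk _ fE] := ac01_ftc (acy (2 - k)%N (ltnW k3)).
have pE v : I01 v -> Dn (3 - k.+1) y v = prim01 (deriv01 (Dn (2 - k) y)) (Dn (2
  - k) y 0) v.
  by move=> Iv; rewrite subSS fE.
have := @prim01_sub_le _ _ intk (Dn (2 - k) y 0) 0 x 0 (k.+2%:R * N4 y) (lexx
  _) x0 x1.
rewrite -!pE ?mul0r ?subr0//; last exact: I01_0.
move=> H; rewrite -[Dn _ y x](subrK (Dn (3 - k.+1) y 0)).
rewrite (le_trans (ler_normD _ _))// -[k.+3%:R]natr1 mulrDl mul1r lerD//;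
  last first.
  by rewrite N4_Dn0// subSS (leq_ltn_trans (leq_subr _ _)).
apply: le_trans (H _) _ => [v /andP[v0 vx]|]; last first.
  by rewrite ler_piMr// mulr_ge0// N4_ge0.
rewrite subr0 (_ : deriv01 _ v = Dn (3 - k) y v).
  by apply: ih; [exact: ltnW|apply/I01P; lra].
by rewrite -DnS -subSn.
Qed.

End H4.

(** * Completeness *)

Section L2_complete.
Context {R : realType}.
Implicit Types (f g : R -> R) (x : R).
Notation lam := (@lebesgue_measure R).
Notation mI := (measurable_I01 : measurable (I01 : set (measurableTypeR R))).
Variable u : nat -> R -> R.
Hypothesis su : forall n, sqint01 (u n).

Let dist2 m n : R := \int[lam]_(v in I01) ((u m v - u n v) ^+ 2).

Hypothesis cauchy_u : forall e : R, 0 < e ->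
  exists N, forall m n, (N <= m)%N -> (N <= n)%N ->
  dist2 m n <= e.

Let sdiff f g : sqint01 f -> sqint01 g -> sqint01 (fun x => f x - g x).
Proof.
move=> sf sg; rewrite (_ : (fun _ => _) = (fun x => 1 * f x + (-1) * g x)).
  exact: sqint01_lin.
by apply/funext => x; ring.
Qed.

Let subseq_ex : exists s : nat -> nat, (forall k, (k <= s k <= s k.+1)%N) /\
  forall k m n, (s k <= m)%N -> (s k <= n)%N -> dist2 m n <= (2^-1 ^+ k) ^+ 2.
Proof.
have /choice[N HN] : forall k, exists N, forall m n, (N <= m)%N -> (N <= n)%N ->
    dist2 m n <= (2^-1 ^+ k) ^+ 2.
  by move=> k; apply: cauchy_u; rewrite !exprn_gt0// invr_gt0.
(* The sum makes the indices monotone and at least [N k]; the summand [k] gives [k <= s k]. *)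
exists (fun k => k + \sum_(j < k.+1) N j)%N; split=> [k|k m n km kn].
  by rewrite leq_addr/= [X in (_ <= _ + X)%N]big_ord_recr/=; lia.
have Nk : (N k <= k + \sum_(j < k.+1) N j)%N by rewrite big_ord_recr/=; lia.
by apply: HN; [exact: leq_trans km|exact: leq_trans kn].
Qed.

(* Riesz-Fischer: almost everywhere convergence along a rapidly Cauchy
   subsequence, then Fatou's lemma. *)
Lemma sqint01_complete : exists2 g, sqint01 g & forall e : R, 0 < e ->
  exists N, forall n, (N <= n)%N -> \int[lam]_(v in I01) ((u n v - g v) ^+ 2)
    <= e.
Proof.
have [s [s_nd sP]] := subseq_ex.
pose d k x : R := u (s k.+1) x - u (s k) x.
have sd k : sqint01 (d k) by exact: sdiff.
have md k : measurable_fun I01 (fun x => `|d k x|%:E).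
  by have [mdk _] := sd k; apply/measurable_EFinP; exact: measurableT_comp.
have int_d k : (\int[lam]_(x in I01) `|d k x|%:E <= (2^-1 ^+ k)%:E)%E.
  have id := integrable_norm (sqint01_integrable (sd k)).
  rewrite -[leLHS]fineK; last exact: (integrable_fin_num mI id).
  rewrite lee_fin; apply: le_trans (sqint01_norm_le (sd k)) _.
  rewrite -[leRHS]ger0_norm ?exprn_ge0 ?invr_ge0// -sqrtr_sqr.
  by apply: ler_wsqrtr; apply: sP => //; have /andP[] := s_nd k.
pose S x := (\sum_(k <oo) `|d k x|%:E)%E.
have mS : measurable_fun I01 S.
  by apply: ge0_emeasurable_sum => // k x _ _; rewrite lee_fin.
have intS : (\int[lam]_(x in I01) S x < +oo)%E.
  rewrite /S integral_nneseries//; last exact: mI.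
  apply: (@le_lt_trans _ _ (\sum_(k <oo) (2 / (2 ^ k.+1)%:R : R)%:E)%E).
    apply: lee_nneseries => [k _ _|k _].
      by apply: integral_ge0 => x _; rewrite lee_fin.
    apply: le_trans (int_d k) _; rewrite lee_fin exprVn natrX exprS invfM mulrA.
    by rewrite divff ?mul1r.
  by apply: le_lt_trans (epsilon_trick0 xpredT _) _; rewrite ?ltry.
have S0 x : (0 <= S x)%E by apply: nneseries_ge0 => k _ _; rewrite lee_fin.
have iS : lam.-integrable I01 S.
  by apply/integrableP; split => //; under eq_integral do rewrite gee0_abs//.
have aeS := integrable_ae mI iS.
pose C : set R := I01 `&` [set x | (S x < +oo)%E].
have mC : measurable C.
  exact: (emeasurable_fun_infty_o mI mS).
(* On [C] the telescoping series converges absolutely. Cutting off outside [C] yields convergence at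
   every point, hence a measurable limit. *)
pose v k x := \1_C x * u (s k) x.
have cvg_v x : cvg (v k x @[k --> \oo]).
  rewrite /v indicE; have [/set_mem[Ix Sx]|_] := boolP (x \in C); last first.
    by under eq_fun do rewrite mul0r; exact: is_cvg_cst.
  under eq_fun do rewrite mul1r.
  have cd : cvgn (series (d ^~ x)).
    apply: normed_cvg; apply: nondecreasing_is_cvgn.
      by apply: nondecreasing_series => k _ _; exact: normr_ge0.
    exists (fine (S x)) => _ [k _ <-]; rewrite -lee_fin fineK; last first.
      by rewrite ge0_fin_numE.
    rewrite /series /= -sumEFin; apply: nneseries_lim_ge => i _ _.
    by rewrite lee_fin.
  have -> : (fun k => u (s k) x) = (fun k => u (s 0) x + series (d ^~ x) k).
    apply/funext => k; rewrite /series /= (eq_bigr (fun k =>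
      u (s k.+1) x - u (s k) x))//.
    by rewrite (telescope_sumr (fun k => u (s k) x))// addrC subrK.
  by apply: is_cvgD => //; exact: is_cvg_cst.
pose g x := lim (v k x @[k --> \oo]).
have m1C : measurable_fun I01 (\1_C : R -> R).
  by apply/measurable_funTS; exact: measurable_indic.
have mv k : measurable_fun I01 (v k).
  by have [mk _] := su (s k); exact: (measurable_funM m1C mk).
have mg : measurable_fun I01 g.
  by apply: (@measurable_fun_cvg _ _ _ _ v) => // x Ix; exact: cvg_v.
have mv2 n k : measurable_fun I01 (fun x => ((v k x - \1_C x * u n x) ^+ 2)%:E).
  have [mn _] := su n; apply/measurable_EFinP/measurable_funX/measurable_funB
    => //.
  exact: (measurable_funM m1C mn).
have aeC : {ae lam, forall x, I01 x -> \1_C x = 1 :> R}.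
  move: aeS; apply: filterS.
  move=> x /= Sfin Ix; rewrite indicE mem_set//; split => //=.
  by rewrite -ge0_fin_numE// Sfin.
have s_ge n m : (n <= m)%N -> (n <= s m)%N.
  by move/leq_trans; apply; have /andP[] := s_nd m.
(* Fatou's lemma with [n] fixed, along the subsequence: its indices eventually exceed [n] because
   [k <= s k]. *)
have key e n : (forall m, (n <= m)%N -> dist2 m n <= e) ->
   (\int[lam]_(x in I01) ((u n x - g x) ^+ 2)%:E <= e%:E)%E.
  move=> de.
  have [mn _] := su n.
  have -> : (\int[lam]_(x in I01) ((u n x - g x) ^+ 2)%:E)%E =
    (\int[lam]_(x in I01) limn_einf (fun k =>
      ((v k x - \1_C x * u n x) ^+ 2)%:E))%E.
    have cvg_f x : ((v k x - \1_C x * u n x) ^+ 2)%:E @[k --> \oo] --> ((g x -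
      \1_C x * u n x) ^+ 2)%:E.
      apply: cvg_EFin; first exact: nearW.
      have cvd : (v k x - \1_C x * u n x) @[k --> \oo] --> g x - \1_C x * u n x.
        by apply: cvgB; [exact: cvg_v|exact: cvg_cst].
      by under eq_fun do rewrite /= expr2; rewrite expr2; exact: cvgM.
    transitivity (\int[lam]_(x in I01) ((g x - \1_C x * u n x) ^+ 2)%:E)%E;
      last first.
      by apply: eq_integral => x _; rewrite (cvg_limn_einf_sup (cvg_f x)).1.
    apply: (ge0_ae_eq_integral mI).
    - by apply/measurable_EFinP/measurable_funX/measurable_funB.
    - apply/measurable_EFinP/measurable_funX/measurable_funB => //.
      exact: (measurable_funM m1C mn).
    - by move=> x _; rewrite lee_fin sqr_ge0.
    - by move=> x _; rewrite lee_fin sqr_ge0.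
    - move: aeC; apply: filterS; first exact: (ae_filter_ringOfSetsType lam).
      move=> x Cx Ix.
      by rewrite /= Cx// mul1r -sqrrN opprB.
  have f0 (k : nat) x : I01 x -> (0%:E <= ((v k x - \1_C x * u n x) ^+ 2)%:E)%E.
    by move=> _; rewrite lee_fin sqr_ge0.
  have F := fatou lam mI (mv2 n) f0.
  apply: (le_trans F).
  rewrite limn_einf_lim; apply: lime_le; first exact: is_cvg_einfs.
  exists n => // k /= nk; apply: (@le_trans _ _ (\int[lam]_(x in I01) ((v k x -
    \1_C x * u n x) ^+ 2)%:E)%E).
    by apply: ereal_inf_lbound; exists k => /=.
  have [_ i2] := sdiff (su (s k)) (su n).
  have := de _ (s_ge _ _ nk); rewrite -lee_fin /dist2 /Rintegral fineK;
    last exact: (integrable_fin_num mI i2).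
  move=> dke; apply: le_trans dke; rewrite le_eqVlt; apply/orP; left; apply/eqP.
  apply: (ge0_ae_eq_integral mI).
  - exact: mv2.
  - exact: (measurable_int lam i2).
  - by move=> x _; rewrite lee_fin sqr_ge0.
  - by move=> x _; rewrite lee_fin sqr_ge0.
  - move: aeC; apply: filterS; first exact: (ae_filter_ringOfSetsType lam).
    by move=> x Cx Ix; rewrite /v Cx// !mul1r.
(* The same bound makes [u n - g] square integrable; then so is [g], as the difference of [u N] and
   [u N - g]. *)
have tail e n : (forall m, (n <= m)%N -> dist2 m n <= e) ->
    sqint01 (fun x => u n x - g x) /\
    \int[lam]_(x in I01) ((u n x - g x) ^+ 2) <= e.
  move=> de; have le_e := key e n de.
  have [mn _] := su n.
  have mun : measurable_fun I01 (fun x => u n x - g x) by exact: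
    measurable_funB.
  have ge0 : (0 <= \int[lam]_(x in I01) ((u n x - g x) ^+ 2)%:E)%E.
    by apply: integral_ge0 => x _; rewrite lee_fin sqr_ge0.
  split.
    split => //; apply/integrableP; split.
      by apply/measurable_EFinP; exact: measurable_funX.
    rewrite (le_lt_trans _ (ltry e))//; apply: le_trans le_e.
    rewrite le_eqVlt; apply/orP; left; apply/eqP.
    by apply: eq_integral => x _ /=; rewrite ger0_norm// sqr_ge0.
  rewrite -lee_fin /Rintegral fineK// ge0_fin_numE//.
  exact: le_lt_trans le_e (ltry e).
exists g; last first.
  move=> e e0; have [N HN] := cauchy_u e0; exists N => n Nn.
  by have [|_] := tail e n => // m nm; apply: HN => //; exact: leq_trans nm.
have [N HN] := cauchy_u ltr01.
have [|sgN _] := tail 1 N; first by move=> m nm; exact: HN.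
rewrite (_ : g = (fun x => u N x - (u N x - g x))); first exact: sdiff.
by apply/funext => x; ring.
Qed.
End L2_complete.

Section H4_complete.
Context {R : realType}.
Implicit Types (f g h y z : R -> R) (x : R).
Notation lam := (@lebesgue_measure R).
Notation mI := (measurable_I01 : measurable (I01 : set (measurableTypeR R))).

(* In the form a * y + b * z of the linearity lemmas. *)
Definition dif y z : R -> R := fun x => 1 * y x + (-1) * z x.

Lemma ac01_integrable f : abs_continuous01 f -> lam.-integrable I01 (EFin \o f).
Proof.
move=> /ac01_clamp_continuous fc.
have := @continuous_compact_integrable R (f \o clamp01) I01 (@segment_compact R
  0 1)
  (continuous_subspaceT fc).
apply: (eq_integrable mI) => x /set_mem/I01P/andP[x0 x1] /=.
by rewrite clamp01_id.
Qed.

Lemma ac01_prim f c : abs_continuous01 f -> [/\ abs_continuous01 (prim01 f c),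
  forall x, I01 x -> has_deriv01 (prim01 f c) x (f x) & prim01 f c 0 = c].
Proof.
move=> acf; have intf := ac01_integrable acf; split.
- exact: prim01_abs_continuous.
- move=> x Ix; apply: prim01_has_deriv => // e e0.
  have [d d0 fd] := ac01_unif acf e0; exists d => // w Iw; exact: fd.
- exact: prim01_0.
Qed.

Lemma H4_ac y i : H4 y -> (i < 4)%N -> abs_continuous01 (Dn i y).
Proof. by move=> [_ + _] => /[apply]. Qed.

Lemma H4_dif y z : H4 y -> H4 z -> H4 (dif y z).
Proof. exact: H4_lin. Qed.

Lemma Dn_dif y z i x : H4 y -> H4 z -> (i < 4)%N -> I01 x ->
  Dn i (dif y z) x = Dn i y x - Dn i z x.
Proof. by move=> Hy Hz i4 Ix; rewrite /dif Dn_lin// mul1r mulN1r. Qed.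

Lemma In4_dif y z : H4 y -> H4 z -> In4 (dif y z) (dif y z) =
  \sum_(i < 4) (Dn i y 0 - Dn i z 0) ^+ 2 +
  \int[lam]_(v in I01) ((Dn 4 y v - Dn 4 z v) ^+ 2).
Proof.
move=> Hy Hz; rewrite In4E; apply: f_equal2.
  by apply: eq_bigr => i _; rewrite Dn_dif//; exact: I01_0.
have [my _] := H4_sqint Hy; have [mz _] := H4_sqint Hz.
have [md _] := H4_sqint (H4_dif Hy Hz).
apply: ae_eq_Rintegral01.
- exact: (measurable_funM md md).
- by apply: measurable_funX; exact: measurable_funB.
- move: (Dn4_lin 1 (-1) Hy Hz); apply: filterS;
  first exact: (ae_filter_ringOfSetsType lam).
  by move=> x dx Ix; rewrite -(dx Ix) mul1r mulN1r.
Qed.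

(** Initial values and fourth derivative map [H4] isometrically to R^4 times L^2. Four successive
    primitives show that this map is onto, so completeness can be checked in these coordinates. *)
Lemma H4_of_primitives (g : R -> R) (c : nat -> R) : sqint01 g ->
  exists z, [/\ H4 z, forall i, (i < 4)%N -> Dn i z 0 = c i &
    {ae lam, forall x, I01 x -> g x = Dn 4 z x}].
Proof.
move=> sg; have ig := sqint01_integrable sg.
pose h3 := prim01 g (c 3); have ac3 : abs_continuous01 h3 by exact:
  prim01_abs_continuous.
have h30 : h3 0 = c 3 by exact: prim01_0.
have [ac2 d2 h20] := ac01_prim (c 2) ac3; set h2 :=
  prim01 h3 (c 2) in ac2 d2 h20.
have [ac1 d1 h10] := ac01_prim (c 1) ac2; set h1 :=
  prim01 h2 (c 1) in ac1 d1 h10.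
have [ac0 d0 z0] := ac01_prim (c 0) ac1; set z := prim01 h1 (c 0) in ac0 d0 z0.
pose h i := nth z [:: z; h1; h2; h3] i.
have hd i x : (i < 3)%N -> I01 x -> has_deriv01 (h i) x (h i.+1 x).
  by case: i => [|[|[|]]]// _ Ix; [exact: d0|exact: d1|exact: d2].
have Dh i x : (i < 4)%N -> I01 x -> h i x = Dn i z x.
  elim: i x => [|i ih] x i4 Ix; first by rewrite Dn0.
  rewrite DnS; apply/esym/has_deriv01_deriv => //;
    apply: eq_has_deriv01 (hd i x _ _) => //.
  by move=> w Iw; apply: ih => //; exact: ltnW.
have ach i : (i < 4)%N -> abs_continuous01 (Dn i z).
  move=> i4; apply: (@eq_abs_continuous01 _ (h i)) => [w Iw|]; first exact: Dh.
  by case: i i4 => [|[|[|[|//]]]] _; [exact: ac0|exact: ac1|exact: ac2|exact: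
    ac3].
have aeg : {ae lam, forall x, I01 x -> g x = Dn 4 z x}.
  have := prim01_ae_deriv ig (c 3); apply: filterS;
    first exact: (ae_filter_ringOfSetsType lam).
  move=> x dx Ix; apply/esym; rewrite DnS; apply: has_deriv01_deriv => //.
  by apply: eq_has_deriv01 (dx Ix) => // w Iw; exact: (Dh 3).
exists z; split => //; last first.
  move=> i i4; rewrite -Dh//; last exact: I01_0.
  by case: i i4 => [|[|[|[|//]]]] _; [exact: z0|exact: h10|exact: h20|exact:
    h30].
split => // [i x i3 Ix|].
  apply: (@has_deriv01_derivable _ _ _ (h i.+1 x)).
  by apply: eq_has_deriv01 (hd i x _ _) => // w Iw; apply: Dh => //;
    exact: ltnW.
apply/L2_01P; apply: ae_eq_sqint01 sg aeg.
by rewrite DnS; apply: measurable_deriv01; apply: ac01_clamp_continuous;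
  exact: ach.
Qed.

Lemma H4_complete (y : nat -> R -> R) : (forall n, H4 (y n)) ->
  (forall e : R, 0 < e -> exists N, forall m n, (N <= m)%N -> (N <= n)%N ->
     N4 (dif (y m) (y n)) <= e) ->
  exists2 z, H4 z & N4 (dif (y n) z) @[n --> \oo] --> (0 : R).
Proof.
move=> Hy cy.
have bound m n e : N4 (dif (y m) (y n)) <= e -> 
    (forall i, (i < 4)%N -> `|Dn i (y m) 0 - Dn i (y n) 0| <= e) /\
    \int[lam]_(v in I01) ((Dn 4 (y m) v - Dn 4 (y n) v) ^+ 2) <= e ^+ 2.
  move=> Ne; split=> [i i4|].
    rewrite -Dn_dif//; last exact: I01_0.
    by rewrite (le_trans (N4_Dn0 _ _)).
  apply: (@le_trans _ _ (N4 (dif (y m) (y n)) ^+ 2)); last first.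
    by rewrite ler_sqr// nnegrE ?N4_ge0// (le_trans (N4_ge0 _) Ne).
  rewrite N4_sqr In4_dif// lerDr.
  by apply: sumr_ge0 => i _; exact: sqr_ge0.
have [g sg gP] : exists2 g, sqint01 g & forall e : R, 0 < e ->
  exists N, forall n,
    (N <= n)%N -> \int[lam]_(v in I01) ((Dn 4 (y n) v - g v) ^+ 2) <= e.
  apply: sqint01_complete => [n|e e0]; first exact: H4_sqint.
  have [|N HN] := cy (Num.sqrt e); first by rewrite sqrtr_gt0.
  exists N => m n Nm Nn; have [_] := bound _ _ _ (HN m n Nm Nn).
  by rewrite sqr_sqrtr// ltW.
have cD (i : nat) : (i < 4)%N -> cvg (Dn i (y n) 0 @[n --> \oo]).
  move=> i4; apply/cauchy_cvgP/cauchy_exP => e e0.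
  have [|N HN] := cy (e / 2); first by rewrite divr_gt0.
  exists (Dn i (y N) 0); exists N => // n /= Nn.
  have [/(_ i i4) + _] := bound _ _ _ (HN N n (leqnn _) Nn).
  by rewrite /ball /=; lra.
have [z [Hz Dz0 aeg]] := H4_of_primitives (fun i =>
  lim (Dn i (y n) 0 @[n --> \oo])) sg.
exists z => //; apply/cvgrPdist_le => e e0.
(* The squared norm has five terms: four initial values and one integral. *)
have e5 : 0 < e ^+ 2 / 5 by rewrite divr_gt0// exprn_gt0.
have [N HN] := gP _ e5.
have cD2 (i : 'I_4) : \forall n \near \oo,
  (Dn i (y n) 0 - Dn i z 0) ^+ 2 <= e ^+ 2 / 5.
  have c : Dn i (y n) 0 @[n --> \oo] --> lim (Dn i (y n) 0 @[n --> \oo]).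
    exact: cD i (ltn_ord i).
  move/cvgrPdist_le : c => /(_ (Num.sqrt (e ^+ 2 / 5))).
  rewrite sqrtr_gt0 Dz0// => /(_ e5); apply: filterS => n.
  rewrite distrC => h; rewrite -real_normK ?num_real// -[leRHS](sqr_sqrtr (ltW
    e5)).
  by rewrite ler_sqr// nnegrE// sqrtr_ge0.
have cD3 := filter_forall _ cD2.
near=> n; rewrite sub0r normrN ger0_norm ?N4_ge0//.
rewrite -ler_sqr ?nnegrE ?N4_ge0 ?(ltW e0)// N4_sqr In4_dif//.
have -> : e ^+ 2 = \sum_(i < 4) (e ^+ 2 / 5) + e ^+ 2 / 5.
  by rewrite sumr_const card_ord -[in LHS](mulr1 (e ^+ 2)) -mulr_natl; field.
apply: lerD.
  apply: ler_sum => i _; move: i; near: n; exact: cD3.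
have -> : \int[lam]_(v in I01) ((Dn 4 (y n) v - Dn 4 z v) ^+ 2) =
    \int[lam]_(v in I01) ((Dn 4 (y n) v - g v) ^+ 2).
  have [my _] := H4_sqint (Hy n); have [mz _] := H4_sqint Hz; have [mg _] := sg.
  apply: ae_eq_Rintegral01.
  - by apply: measurable_funX; exact: measurable_funB.
  - by apply: measurable_funX; exact: measurable_funB.
  - move: aeg; apply: filterS; first exact: (ae_filter_ringOfSetsType lam).
    by move=> x gx Ix; rewrite gx.
apply: HN; near: n; exact: nbhs_infty_ge.
Unshelve. all: by end_near.
Qed.
End H4_complete.

(** * The reproducing kernel *)

Section kernel.
Context {R : realType}.
Implicit Types (f g h : R -> R) (x y s : R).
Notation lam := (@lebesgue_measure R).
Notation mI := (measurable_I01 : measurable (I01 : set (measurableTypeR R))).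

Lemma lipschitz_ac01 f (L : R) :
  (forall x y, I01 x -> I01 y -> x <= y -> `|f y - f x| <= L * (y - x)) ->
  abs_continuous01 f.
Proof.
move=> fL e e0; have L1 : 0 < `|L| + 1 by rewrite ltr_wpDl.
exists (e / (`|L| + 1)) => [|n a b ab _ lend]; first by rewrite divr_gt0.
apply: (@le_lt_trans _ _ (\sum_(i < n) (`|L| + 1) * (b i - a i))).
  apply: ler_sum => i _; have [a0 [aib b1]] := ab i.
  apply: le_trans (fL _ _ _ _ aib) _; [by apply/I01P; lra|by apply/I01P; lra|].
  by apply: ler_wpM2r; [rewrite subr_ge0|have := ler_norm L; lra].
by rewrite -mulr_sumr mulrC -ltr_pdivlMr.
Qed.

Lemma kerQ_ac s : abs_continuous01 (kerQ s).
Proof.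
apply: (@lipschitz_ac01 _ 1) => x y _ _ xy; rewrite mul1r ler_norml /kerQ.
by case: ifPn => ys; case: ifPn => xs; move: ys xs; rewrite -?ltNge; lra.
Qed.

Lemma kerQ_has_deriv s x : I01 x -> x != s ->
  has_deriv01 (kerQ s) x (\1_(`[0, s]%classic) x).
Proof.
move=> /I01P/andP[x0 x1] xs e e0; exists `|s - x|;
  first by rewrite normr_gt0 subr_eq0 eq_sym.
move=> w Iw wx wd; have wx0 : w - x != 0 by rewrite subr_eq0.
rewrite indicE mem_setE in_itv/= x0/= /quot01 /kerQ.
move: xs; rewrite neq_lt => /orP[xs|sx].
  have ws : w <= s by move: wd; rewrite [X in _ < X]gtr0_norm ?subr_gt0//
    ltr_norml; lra.
  rewrite ws (ltW xs) (_ : 1 + w - (1 + x) = w - x); last ring.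
  by rewrite divff// subrr normr0 ltW.
have ws : s < w.
  by move: wd; rewrite [X in _ < X]ltr0_norm ?subr_lt0// ltr_norml; lra.
by rewrite [w <= s]leNgt ws [x <= s]leNgt sx/= subrr mul0r subrr normr0 ltW.
Qed.

Lemma kerQ_ae_deriv s : {ae lam, forall x, I01 x ->
  \1_(`[0, s]%classic) x = deriv01 (kerQ s) x}.
Proof.
exists [set s]; split; [exact: measurable_set1|exact: lebesgue_measure_set1|].
move=> x /= nx; apply: contrapT => xs; apply: nx => Ix.
by apply/esym/has_deriv01_deriv => //; apply: kerQ_has_deriv => //; apply/eqP.
Qed.

Lemma kerQ_deriv_sqint s : sqint01 (deriv01 (kerQ s)).
Proof.
have m1 : measurable_fun I01 (\1_(`[0, s]%classic) : R -> R).
  by apply: measurable_funTS; apply: measurable_indic; exact: measurable_itv.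
apply: (@ae_eq_sqint01 _ (\1_(`[0, s]%classic))).
- by apply: measurable_deriv01; apply: ac01_clamp_continuous; exact: kerQ_ac.
- split => //; apply: (@integrable01_bounded _ _ _ 1) => //; first exact: mI.
    exact: measurable_funX.
  by move=> v _; rewrite indicE; case: (_ \in _);
    rewrite ?expr1n ?expr0n ?normr1 ?normr0.
- exact: kerQ_ae_deriv.
Qed.

Lemma W21_kerQ s : W21 (kerQ s).
Proof. by split; [exact: kerQ_ac|apply/L2_01P; exact: kerQ_deriv_sqint]. Qed.

(** The kernel has value 1 at 0 and its derivative is almost everywhere the indicator of [0, s], so
    the inner product is [f 0] plus the integral of the derivative of [f] up to [s]. *)
Lemma inner1_kerQ f s : abs_continuous01 f -> I01 s -> inner1 f (kerQ s) = f s.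
Proof.
move=> acf Is; have [intf _ fE] := ac01_ftc acf; have /I01P/andP[s0 s1] := Is.
rewrite /inner1 [in RHS]fE// /kerQ s0 addr0 mulr1; congr (_ + _).
have [mQ _] := kerQ_deriv_sqint s.
have mf : measurable_fun I01 (deriv01 f).
  by apply: measurable_deriv01; exact: ac01_clamp_continuous.
transitivity (\int[lam]_(v in I01) (deriv01 f \_ `[0, s]) v).
  apply: ae_eq_Rintegral01.
  - exact: (measurable_funM mf mQ).
  - apply/measurable_restrict => //; first exact: measurable_itv.
    by apply: measurable_funS mf => //; exact: mI.
  - move: (kerQ_ae_deriv s); apply: filterS;
    first exact: (ae_filter_ringOfSetsType lam).
    move=> x Qx Ix; rewrite -/(kerQ s) -(Qx Ix) indicE /patch.
    by case: ifP => _; rewrite ?mulr1 ?mulr0.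
rewrite -Rintegral_mkcondr; congr (Rintegral _ _ _).
apply/seteqP; split => [x []//|x /[dup] xs];
  rewrite /= in_itv/= => /andP[x0 xs'].
by split => //; apply/I01P; lra.
Qed.

End kernel.

(** * Polynomial test functions *)

Section polynomial.
Context {R : realType}.
Implicit Types (p q : {poly R}) (x : R).
Notation lam := (@lebesgue_measure R).
Notation mI := (measurable_I01 : measurable (I01 : set (measurableTypeR R))).

(** By the factor theorem the difference quotient at [x] is a polynomial [q], which is continuous
    and takes the value of the derivative at [x]. *)
Lemma horner_has_deriv01 p x : has_deriv01 (horner p) x p^`().[x].
Proof.
have /factor_theorem[q pq] : root (p - p.[x]%:P) x.
  by rewrite /root hornerD hornerN hornerC subrr.
have -> : p^`().[x] = q.[x].
  have := congr1 (fun r => r^`().[x]) pq.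
  rewrite derivB derivC subr0 => ->; rewrite derivM derivXsubC.
  by rewrite !hornerE subrr mulr0 add0r.
move=> e e0; have /cvgrPdist_le/(_ e e0)[d /= d0 qd] :=
  @continuous_horner R q x.
exists d => // w _ wx wd; rewrite /quot01 distrC.
have wx0 : w - x != 0 by rewrite subr_eq0.
have -> : p.[w] - p.[x] = q.[w] * (w - x).
  have := congr1 (horner^~ w) pq; rewrite !hornerE => <-.
  by [].
by rewrite mulfK//; apply: qd => /=; rewrite distrC.
Qed.

(** Both bounds go through one induction, since the Lipschitz estimate for [p * 'X + c] uses the
    bound on [p]. *)
Lemma horner_bounded_lipschitz p : exists L : R, [/\ 0 <= L,
  forall x, I01 x -> `|p.[x]| <= L &
  forall x y, I01 x -> I01 y -> x <= y -> `|p.[y] - p.[x]| <= L * (y - x)].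
Proof.
elim/poly_ind: p => [|p c [L [L0 pL pLip]]].
  exists 0; split=> // [x _|x y _ _ _]; rewrite !horner0 ?normr0//.
  by rewrite subrr normr0 mul0r.
exists (2 * L + `|c|); split=> [|x Ix|x y Ix Iy xy].
- by rewrite addr_ge0// mulr_ge0.
- have /I01P/andP[x0 x1] := Ix; rewrite !hornerE.
  rewrite (le_trans (ler_normD _ _))// lerD// normrM (ger0_norm x0).
  have := pL x Ix; have := normr_ge0 p.[x]; nra.
- have /I01P/andP[y0 y1] := Iy; rewrite !hornerE.
  rewrite (_ : _ - _ = (p.[y] - p.[x]) * y + p.[x] * (y - x)); last ring.
  rewrite (le_trans (ler_normD _ _))// !normrM (ger0_norm y0).
  rewrite (ger0_norm (_ : 0 <= y - x)) ?subr_ge0//.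
  have := pL x Ix; have := pLip x y Ix Iy xy; have := normr_ge0 (p.[y] - p.[x]).
  have := normr_ge0 c; have : 0 <= y - x by rewrite subr_ge0.
  nra.
Qed.

Lemma horner_ac01 p : abs_continuous01 (horner p).
Proof. by have [L [_ _ pL]] := horner_bounded_lipschitz p;
  exact: lipschitz_ac01 pL. Qed.

Lemma Dn_horner p i x : I01 x -> Dn i (horner p) x = p^`(i).[x].
Proof.
elim: i x => [|i ih] x Ix; first by rewrite Dn0 derivn0.
rewrite DnS derivnS; apply: has_deriv01_deriv => //.
by apply: eq_has_deriv01 (@horner_has_deriv01 p^`(i) x) => // w Iw; rewrite ih.
Qed.

Lemma H4_horner p : H4 (horner p).
Proof.
have ac i : abs_continuous01 (Dn i (horner p)).
  by apply: eq_abs_continuous01 (@horner_ac01 p^`(i)) => w Iw;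
    rewrite Dn_horner.
split=> // [i x _ Ix|].
  apply: (@has_deriv01_derivable _ _ _ p^`(i.+1).[x]).
  rewrite derivnS; apply: eq_has_deriv01 (@horner_has_deriv01 p^`(i) x) =>
    // w Iw.
  by rewrite Dn_horner.
apply/L2_01P; apply: (@ae_eq_sqint01 _ (horner p^`(4))).
- by rewrite DnS; apply: measurable_deriv01; apply: ac01_clamp_continuous;
  exact: ac.
- have mp : measurable_fun I01 (horner p^`(4)).
    by apply: measurable_funTS; apply: continuous_measurable_fun;
      exact: continuous_horner.
  have [L [L0 pL _]] := horner_bounded_lipschitz p^`(4); split => //.
  apply: (@integrable01_bounded _ _ _ (L ^+ 2)) => //; first exact: mI.
    exact: measurable_funX.
  by move=> v Iv; rewrite normrX ler_sqr ?nnegrE// pL.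
- by apply: aeW => x Ix; rewrite Dn_horner.
Qed.

Lemma poly_antideriv p : exists P : {poly R}, P^`() = p.
Proof.
exists (\poly_(i < (size p).+1) (p`_i.-1 / i%:R)).
apply/polyP => i; rewrite coef_deriv coef_poly ltnS.
case: ltnP => [_|pi]; last by rewrite mul0rn nth_default.
by rewrite /= -[LHS]mulr_natr divfK// pnatr_eq0.
Qed.

(** The constant [m] is the mean of [p] on [0,1]. *)
Lemma poly_periodic_antideriv p : exists P : {poly R}, exists m : R,
  P^`() = p - m%:P /\ P.[1] = P.[0].
Proof.
have [Q Q'] := poly_antideriv p; exists (Q - (Q.[1] - Q.[0]) *: 'X).
exists (Q.[1] - Q.[0]); split; last by rewrite !hornerE; ring.
by rewrite derivB derivZ derivX Q' alg_polyC.
Qed.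

(** The hypothesis says that the derivative of [P] has mean zero. Two periodic integrations lead
    from [P] to [w]; the constants they subtract disappear from the third derivative. *)
Lemma W24_of_zero_mean P : P.[1] = P.[0] ->
  exists w : R -> R, W24 w /\ forall x, I01 x -> Dn 3 w x = P^`().[x].
Proof.
move=> P10; have [Q [m [Q' Q10]]] := poly_periodic_antideriv P.
have [C [k [C' C10]]] := poly_periodic_antideriv Q.
have C1 : C^`(1) = Q - k%:P by rewrite derivn1.
have C2 : C^`(2) = P - m%:P by rewrite derivnS C1 derivB derivC subr0.
have C3 : C^`(3) = P^`() by rewrite derivnS C2 derivB derivC subr0.
exists (horner C); split; last by move=> x Ix; rewrite Dn_horner// C3.
apply/W24P; split; first exact: H4_horner.
move=> i; rewrite !Dn_horner; [|exact: I01_1|exact: I01_0].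
by case: i => [|[|[|]]]// _; rewrite ?derivn0 ?C1 ?C2 ?hornerE ?C10 ?Q10 ?P10.
Qed.

(** Equal end values would make the monotone [p] constant on [0,1], and its derivative would vanish
    there. *)
Lemma horner_increasing p x0 : (forall x, I01 x -> 0 <= p^`().[x]) ->
  I01 x0 -> p^`().[x0] != 0 -> p.[1] != p.[0].
Proof.
move=> dp0 I0 dpx0; apply/negP => /eqP p10; move/negP: dpx0; apply; apply/eqP.
have [intp _ pE] := ac01_ftc (horner_ac01 p).
have dE x : I01 x -> deriv01 (horner p) x = p^`().[x].
  by move=> Ix; apply: has_deriv01_deriv => //; exact: horner_has_deriv01.
have mono x y : 0 <= x -> x <= y -> y <= 1 -> p.[x] <= p.[y].
  move=> x0' xy y1; rewrite -subr_ge0.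
  rewrite (pE x) ?(pE y); [|apply/I01P; lra..].
  rewrite -[X in 0 <= X - _]/(prim01 (deriv01 (horner p)) p.[0] y) -[X in 0 <=
    _ - X]/(prim01 (deriv01 (horner p)) p.[0] x).
  rewrite prim01_sub//; apply: Rintegral_ge0 => v /=;
    rewrite in_itv/= => /andP[xv vy].
  by have Iv : I01 v; [apply/I01P; lra|rewrite dE// dp0].
have cst_p x : I01 x -> p.[x] = p.[0].
  move=> /I01P/andP[x0' x1]; apply/eqP; rewrite eq_le; apply/andP.
  by split; [rewrite -p10; exact: mono|exact: mono].
rewrite -dE//; apply: has_deriv01_deriv => //.
apply: (@eq_has_deriv01 _ (fun=> p.[0])) => // [w Iw|]; first by rewrite cst_p.
by move=> e e0; exists 1 => // w _ _ _; rewrite /quot01 subrr mul0r subrr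
  normr0 ltW.
Qed.

(** The third derivative of [w] is [q * (b - a * (x - t n) ^+ 2)], with [a] and [b] the integrals of
    [q] and of [q * (x - t n) ^+ 2]; its mean is [b * a - a * b = 0]. At [t n] it equals [b] times
    the nonzero [q.[t n]]. The squares in [q] make the integrand of [b] nonnegative. *)
Lemma W24_separating (t : nat -> R) (n : nat) : (forall i, I01 (t i)) ->
  injective t ->
  exists w : R -> R, [/\ W24 w, forall k, (k < n)%N -> Dn 3 w (t k) = 0 &
    Dn 3 w (t n) != 0].
Proof.
move=> t01 tinj.
pose q : {poly R} := \prod_(k < n) ('X - (t k)%:P) ^+ 2.
have qE x : q.[x] = \prod_(k < n) (x - t k) ^+ 2.
  by rewrite /q horner_prod; apply: eq_bigr => k _; rewrite !hornerE.
have q_ge0 x : 0 <= q.[x] by rewrite qE prodr_ge0// => k _; exact: sqr_ge0.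
have q_neq0 m : (n <= m)%N -> q.[t m] != 0.
  move=> nm; rewrite qE; apply/prodf_neq0 => k _.
  rewrite sqrf_eq0 subr_eq0; apply/eqP => /tinj mk.
  by have := ltn_ord k; rewrite -mk ltnNge nm.
have q_eq0 k : (k < n)%N -> q.[t k] = 0.
  by move=> kn; rewrite qE (bigD1 (Ordinal kn))//= subrr expr0n mul0r.
have [A1 A1'] := poly_antideriv q.
have [A2 A2'] := poly_antideriv (q * ('X - (t n)%:P) ^+ 2).
have rE x : (q * ('X - (t n)%:P) ^+ 2).[x] = q.[x] * (x - t n) ^+ 2.
  by rewrite hornerM horner_exp hornerXsubC.
pose a := A1.[1] - A1.[0]; pose b := A2.[1] - A2.[0].
have b0 : b != 0.
  (* The integrand of [b] is nonzero at [t n.+1], which differs from all of [t 0], ..., [t n]. *)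
  rewrite subr_eq0; apply: (@horner_increasing _ (t n.+1)) => // [x Ix|];
    rewrite A2' rE.
    by rewrite mulr_ge0// sqr_ge0.
  rewrite mulf_neq0 ?q_neq0// sqrf_eq0 subr_eq0; apply/eqP => /tinj.
  by move/eqP; rewrite eqn_leq ltnn.
have [|w [Ww Dw]] := @W24_of_zero_mean (b *: A1 - a *: A2).
  by rewrite !hornerE /a /b; ring.
have wE x : I01 x -> Dn 3 w x = q.[x] * (b - a * (x - t n) ^+ 2).
  by move=> Ix; rewrite Dw// derivB !derivZ A1' A2' hornerD hornerN !hornerZ
    rE; ring.
exists w; split => // [k kn|]; rewrite wE//; first by rewrite q_eq0// mul0r.
by rewrite subrr expr0n/= mulr0 subr0 mulf_neq0// q_neq0.
Qed.

End polynomial.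

(** * Gram-Schmidt orthonormalization *)

Section gram_schmidt.
Context {R : realType}.
Implicit Types (y z w : R -> R) (x : R).

Definition lincomb (c : nat -> R) (f : nat -> R -> R) (n : nat) : R -> R :=
  fun x => \sum_(i < n) c i * f i x.

Lemma lincombS c f n : lincomb c f n.+1 = (fun x =>
  1 * lincomb c f n x + c n * f n x).
Proof. by apply/funext => x; rewrite /lincomb big_ord_recr/= mul1r. Qed.

Lemma lincomb0 c f : lincomb c f 0 = horner 0.
Proof. by apply/funext => x; rewrite /lincomb big_ord0 horner0. Qed.

Lemma H4_lincomb c f n : (forall i, (i < n)%N -> H4 (f i)) ->
  H4 (lincomb c f n).
Proof.
elim: n => [|n ih] Hf; first by rewrite lincomb0; exact: H4_horner.
rewrite lincombS; apply: H4_lin; last exact: Hf.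
by apply: ih => i ni; apply: Hf; exact: ltnW.
Qed.

Lemma In4_lincomb c f n w : (forall i, (i < n)%N -> H4 (f i)) -> H4 w ->
  In4 (lincomb c f n) w = \sum_(i < n) c i * In4 (f i) w.
Proof.
move=> + Hw; elim: n => [|n ih] Hf.
  have := In4_lin 0 0 (H4_horner 0) (H4_horner 0) Hw.
  rewrite !mul0r addr0 big_ord0 lincomb0 => <-; congr In4.
  by apply/funext => x; rewrite horner0 !mulr0 addr0.
have Hf' i : (i < n)%N -> H4 (f i) by move=> ni; apply: Hf; exact: ltnW.
rewrite lincombS In4_lin//; [|exact: H4_lincomb|exact: Hf].
by rewrite big_ord_recr/= ih// mul1r.
Qed.

Variable v : nat -> R -> R.
Notation e := (gram_schmidt v).

Definition gs_residual m : R -> R :=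
  fun x => 1 * v m x + (-1) * lincomb (fun i => In4 (v m) (e i)) e m x.

Lemma size_gram_schmidt_seq m : size (gram_schmidt_seq v m) = m.
Proof. by elim: m => //= m ih; rewrite size_rcons ih. Qed.

Lemma gram_schmidt_seqE m : gram_schmidt_seq v m = [seq e i | i <- iota 0 m].
Proof.
elim: m => [//|m ih]; rewrite -[in iota _ _]addn1 iotaD map_cat -ih cats1 add0n.
rewrite /gram_schmidt [in RHS]/=.
rewrite nth_rcons size_gram_schmidt_seq ltnn eqxx.
by [].
Qed.

Lemma gram_schmidtE m : e m = (fun x => (N4 (gs_residual m))^-1 * gs_residual m
  x).
Proof.
rewrite /gram_schmidt /= nth_rcons size_gram_schmidt_seq ltnn eqxx.
have resE : (fun x => v m x - \sum_(e0 <- gram_schmidt_seq v m) inner4 (v m) e0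
  * e0 x)
    = gs_residual m.
  apply/funext => x; rewrite gram_schmidt_seqE big_map inner4In4 /gs_residual.
  rewrite mul1r mulN1r; apply: (f_equal (fun a => v m x - a)).
  by rewrite /lincomb -(big_mkord xpredT (fun i =>
    In4 (v m) (e i) * e i x)) /index_iota subn0.
apply/funext => x; rewrite resE norm4N4.
by have /= -> := congr1 (fun f => f x) resE.
Qed.

Hypothesis Hv : forall k, H4 (v k).

Lemma gram_schmidt_H4 m : H4 (e m).
Proof.
have [n mn] := ubnP m; elim: n m mn => // n ih m mn; rewrite gram_schmidtE.
have Hu : H4 (gs_residual m).
  apply: H4_lin => //; apply: H4_lincomb => i im; apply: ih.
  exact: leq_trans im _.
rewrite (_ : (fun _ => _) = (fun x => (N4 (gs_residual m))^-1 * gs_residual m x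
  + 0 * v m x)).
  exact: H4_lin.
by apply/funext => x; rewrite mul0r addr0.
Qed.

Lemma gs_residual_H4 m : H4 (gs_residual m).
Proof. by apply: H4_lin => //; apply: H4_lincomb => i _;
  exact: gram_schmidt_H4. Qed.

Lemma In4_gs_residual m w : H4 w -> In4 (gs_residual m) w =
  In4 (v m) w - \sum_(i < m) In4 (v m) (e i) * In4 (e i) w.
Proof.
move=> Hw; rewrite /gs_residual In4_lin//.
  rewrite mul1r mulN1r In4_lincomb// => i _; exact: gram_schmidt_H4.
by apply: H4_lincomb => i _; exact: gram_schmidt_H4.
Qed.

Lemma In4_gram_schmidt m w : H4 w ->
  In4 (e m) w = (N4 (gs_residual m))^-1 * In4 (gs_residual m) w.
Proof.
move=> Hw; rewrite {1}gram_schmidtE.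
rewrite (_ : (fun _ => _) = (fun x => (N4 (gs_residual m))^-1 * gs_residual m x
  + 0 * v m x)).
  by rewrite In4_lin ?mul0r ?addr0//; exact: gs_residual_H4.
by apply/funext => x; rewrite mul0r addr0.
Qed.

(** A dual form of the fact that [e k] lies in the span of [v 0], ..., [v k], which avoids tracking
    coefficients. *)
Lemma In4_gram_schmidt_eq0 w n : H4 w -> (forall k, (k < n)%N ->
  In4 (v k) w = 0) ->
  forall k, (k < n)%N -> In4 (e k) w = 0.
Proof.
move=> Hw vw k; have [N kN] := ubnP k; elim: N k kN => // N ih k kN kn.
rewrite In4_gram_schmidt// In4_gs_residual// vw// big1 ?subr0 ?mulr0// => i _.
by rewrite ih ?mulr0//; [exact: leq_trans (ltn_ord i) _|exact: ltn_trans kn].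
Qed.

Hypothesis v_free : forall n, exists w, [/\ H4 w,
  forall k, (k < n)%N -> In4 (v k) w = 0 & In4 (v n) w != 0].

(** The [w] of [v_free] pairs with the residual as it does with [v m], that is, to a nonzero number;
    by Cauchy-Schwarz the residual cannot have norm 0. *)
Lemma N4_gs_residual_gt0 m : 0 < N4 (gs_residual m).
Proof.
rewrite lt_neqAle N4_ge0 andbT eq_sym; apply/eqP => N0.
have [w [Hw wk /eqP]] := v_free m; apply.
have := In4_cauchy (gs_residual_H4 m) Hw; rewrite N0 mul0r normr_le0 => /eqP.
rewrite In4_gs_residual// big1 ?subr0// => i _.
by rewrite (In4_gram_schmidt_eq0 Hw wk (ltn_ord i)) mulr0.
Qed.

Lemma gram_schmidt_orthonormal i j : In4 (e i) (e j) = (i == j)%:R.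
Proof.
have Nn0 m : N4 (gs_residual m) != 0 by rewrite gt_eqF// N4_gs_residual_gt0.
have He := gram_schmidt_H4.
suff H n : forall i j, (i <= j)%N -> (j < n)%N -> In4 (e i) (e j) = (i == j)%:R.
  have [ij|/ltnW ji] := leqP i j; first exact: (H j.+1).
  by rewrite In4C eq_sym (H i.+1).
elim: n => // n ih {}i {}j ij; rewrite ltnS leq_eqVlt => /predU1P[jn|];
  last exact: ih.
subst j; move: ij; rewrite leq_eqVlt => /predU1P[->|ni].
  rewrite eqxx In4_gram_schmidt// In4C In4_gram_schmidt//;
    last exact: gs_residual_H4.
  by rewrite -N4_sqr expr2 mulKf// mulVf.
rewrite ltn_eqF// In4C In4_gram_schmidt// In4_gs_residual//.
have ih' k : (k < n)%N -> In4 (e k) (e i) = (k == i)%:R.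
  move=> kn; have [ki|/ltnW ik] := leqP k i; first exact: ih.
  by rewrite In4C eq_sym ih.
rewrite (bigD1 (Ordinal ni))//= ih'// eqxx mulr1 big1 ?addr0 ?subrr ?mulr0// =>
  k ki.
by rewrite ih'// -[(k : nat) == i]/(k == Ordinal ni) (negbTE ki) mulr0.
Qed.

Lemma In4_gram_schmidt_neq0 w n : H4 w -> (forall k, (k < n)%N ->
  In4 (v k) w = 0) ->
  In4 (v n) w != 0 -> In4 (e n) w != 0.
Proof.
move=> Hw wk wn; rewrite In4_gram_schmidt// mulf_neq0//.
  by rewrite invr_eq0 gt_eqF// N4_gs_residual_gt0.
rewrite In4_gs_residual// big1 ?subr0// => i _.
by rewrite (In4_gram_schmidt_eq0 Hw wk (ltn_ord i)) mulr0.
Qed.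

End gram_schmidt.

(** * Convergence of the numerical solutions *)

Section convergence.
Context {R : realType}.
Implicit Types (y z w : R -> R) (x : R).

Lemma W24_H4 y : W24 y -> H4 y. Proof. by move=> /W24P[]. Qed.

Lemma Dn_cvg (S : nat -> R -> R) z : (forall n, H4 (S n)) -> H4 z ->
  N4 (dif (S n) z) @[n --> \oo] --> (0 : R) ->
  forall e : R, 0 < e -> exists N, forall n i x, (N <= n)%N -> (i < 4)%N ->
    I01 x ->
    `|Dn i (S n) x - Dn i z x| <= e.
Proof.
move=> HS Hz /cvgrPdist_le Sz e e0.
(* 5 is the largest factor in [N4_Dn], reached for [i = 0]. *)
have [|N _ HN] := Sz (e / 5); first by rewrite divr_gt0.
exists N => n i x /HN; rewrite /= sub0r normrN ger0_norm ?N4_ge0// => Ne i4 Ix.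
rewrite -Dn_dif//; have i3 : (i <= 3)%N by [].
have := N4_Dn (H4_dif (HS n) Hz) (_ : (3 - i < 4)%N) Ix; rewrite subKn// => H.
apply: le_trans (H _) _; first by rewrite ltnS leq_subr.
have : (3 - i).+2%:R <= 5 :> R by rewrite ler_nat !ltnS leq_subr.
move: (_.+2%:R) => c c5; have := N4_ge0 (dif (S n) z).
move: (N4 _) Ne => N4d Nd Nd0.
by apply: (@le_trans _ _ (5 * N4d)); [exact: ler_wpM2r|lra].
Qed.

Lemma lincomb_periodic (c : nat -> R) (f : nat -> R -> R) n i :
  (forall k, W24 (f k)) -> (i < 3)%N ->
  Dn i (lincomb c f n) 0 = Dn i (lincomb c f n) 1.
Proof.
move=> Wf i3; have Hf k := W24_H4 (Wf k); elim: n => [|n ih].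
  rewrite lincomb0 !Dn_horner; [|exact: I01_1|exact: I01_0].
  by rewrite (_ : (0 : {poly R}) ^`(i) = 0) ?horner0// raddf0.
rewrite lincombS !Dn_lin//; [|exact: H4_lincomb|exact: ltnW|exact: I01_1|exact:
  H4_lincomb|exact: ltnW|exact: I01_0].
by have /W24P[_ ->//] := Wf n; rewrite ih.
Qed.

Variables (t : nat -> R) (psi : nat -> R -> R).
Hypothesis t_01 : forall i, I01 (t i).
Hypothesis t_inj : injective t.
Hypothesis Wpsi : forall k, W24 (psi k).
Hypothesis psi_repr : forall k w, W24 w -> In4 w (psi k) = Dn 3 w (t k).
Notation e := (gram_schmidt psi).

Let Hpsi k : H4 (psi k) := W24_H4 (Wpsi k).

Let psi_free n : exists w, [/\ H4 w, forall k, (k < n)%N -> In4 (psi k) w = 0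
  & In4 (psi n) w != 0].
Proof.
have [w [Ww wk wn]] := W24_separating n t_01 t_inj; exists w; split.
- exact: W24_H4.
- by move=> k kn; rewrite In4C psi_repr// wk.
- by rewrite In4C psi_repr.
Qed.

Let He k : H4 (e k) := gram_schmidt_H4 Hpsi k.
Let orth := gram_schmidt_orthonormal Hpsi psi_free.

Variables (beta : nat -> nat -> R) (A : nat -> R) (Fk : nat -> R).
Hypothesis betaE : forall i x, I01 x -> e i x =
  \sum_(k < i.+1) beta i k * psi k x.
Hypothesis AE : forall i, A i = \sum_(k < i.+1) beta i k * Fk k.

Let We k : W24 (e k).
Proof.
apply/W24P; split=> // i i3.
have eE x : I01 x -> Dn i (e k) x = Dn i (lincomb (beta k) psi k.+1) x.
  by move=> Ix; apply: eq_Dn => // v Iv; rewrite betaE.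
rewrite (eE 0 I01_0) (eE 1 I01_1); exact: lincomb_periodic.
Qed.

Let In4_e i w : H4 w -> In4 (e i) w = \sum_(k < i.+1) beta i k * In4 (psi k) w.
Proof.
move=> Hw; rewrite (@eq_In4 _ _ (lincomb (beta i) psi i.+1) w w)//; last first.
  by move=> x Ix; rewrite betaE.
by rewrite In4_lincomb.
Qed.

(** Pairing [e i] with a test function that annihilates [psi k] for [k < i] leaves only the diagonal
    term, and this pairing is nonzero. *)
Let beta_diag i : beta i i != 0.
Proof.
have [w [Hw wk wi]] := psi_free i.
have := In4_gram_schmidt_neq0 Hpsi psi_free Hw wk wi.
rewrite In4_e// big_ord_recr/= big1 ?add0r; last by move=> k _;
  rewrite wk// mulr0.
by rewrite mulf_eq0 negb_or => /andP[].
Qed.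

Let S n := lincomb A e n.

Let HS n : H4 (S n). Proof. by apply: H4_lincomb. Qed.

Let In4_S n i : In4 (S n) (e i) = if (i < n)%N then A i else 0.
Proof.
rewrite In4_lincomb//; case: ltnP => [ni|ni].
  rewrite (bigD1 (Ordinal ni))//= orth eqxx mulr1 big1 ?addr0// => k ki.
  by rewrite orth -[(k : nat) == i]/(k == Ordinal ni) (negbTE ki) mulr0.
by rewrite big1// => k _; rewrite orth ltn_eqF ?mulr0// (leq_trans (ltn_ord k)).
Qed.

Let a n : R := \sum_(i < n) A i ^+ 2.

Let In4_SS m n : (n <= m)%N -> In4 (S m) (S n) = a n.
Proof.
move=> nm; rewrite In4C In4_lincomb//; apply: eq_bigr => i _.
by rewrite In4C In4_S (leq_trans (ltn_ord i) nm).
Qed.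

Let In4_Sdif m n : (n <= m)%N -> In4 (dif (S m) (S n)) (dif (S m) (S n)) =
  a m - a n.
Proof.
move=> nm; rewrite /dif In4_lin//; last exact: H4_dif.
rewrite !In4_linr// (In4C (S n) (S m)) (In4_SS nm) !(In4_SS (leqnn _)); ring.
Qed.

Hypothesis S_bounded : exists M : R, forall n, N4 (lincomb A e n) <= M.

Let a_cvg : cvg (a n @[n --> \oo]).
Proof.
have [M SM] := S_bounded; apply: nondecreasing_is_cvgn.
  apply/nondecreasing_seqP => n; rewrite /a big_ord_recr/= lerDl;
    exact: sqr_ge0.
exists (M ^+ 2) => _ [n _ <-]; rewrite -(In4_SS (leqnn n)) -N4_sqr ler_sqr
  ?nnegrE ?N4_ge0//.
exact: le_trans (N4_ge0 _) (SM n).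
Qed.

Let S_cauchy (d : R) : 0 < d -> exists N, forall m n, (N <= m)%N ->
  (N <= n)%N ->
  N4 (dif (S m) (S n)) <= d.
Proof.
move=> d0; have d2 : 0 < d ^+ 2 / 2 by rewrite divr_gt0// exprn_gt0.
have /cvgrPdist_le/(_ _ d2)[N _ HN] : a n @[n --> \oo] --> lim (a n @[n -->
  \oo]) by exact: a_cvg.
exists N => m n /HN/= Hm /HN/= Hn.
rewrite -ler_sqr ?nnegrE ?N4_ge0 ?(ltW d0)// N4_sqr.
have aa : `|a m - a n| <= d ^+ 2.
  rewrite (_ : a m - a n = (lim (a n @[n --> \oo]) - a n) - (lim (a n @[n -->
    \oo]) - a m)); last ring.
  by rewrite (le_trans (ler_normB _ _))// [leRHS]splitr lerD.
have [nm|/ltnW mn] := leqP n m.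
  by rewrite In4_Sdif// (le_trans (ler_norm _)).
have -> : In4 (dif (S m) (S n)) (dif (S m) (S n)) =
  In4 (dif (S n) (S m)) (dif (S n) (S m)).
  rewrite !In4_dif//; apply: f_equal2; last by apply: eq_Rintegral => v _; ring.
  by apply: eq_bigr => i _; ring.
by rewrite In4_Sdif// (le_trans (ler_norm _))// distrC.
Qed.

(** Here [Fk] is an arbitrary sequence of data: the limit interpolates it with its third derivative
    at the points [t k], wherever the data come from. *)
Lemma gram_schmidt_expansion_cvg : exists z, [/\ W24 z,
  N4 (dif (lincomb A e n) z) @[n --> \oo] --> (0 : R) & forall k,
    Dn 3 z (t k) = Fk k].
Proof.
have [z Hz Sz] := H4_complete HS S_cauchy.
have Wz : W24 z.
  apply/W24P; split => // i i3.
  apply/eqP; rewrite -subr_eq0 -normr_le0; apply/ler_addgt0Pr => d d0;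
    rewrite add0r.
  have d2 : 0 < d / 2 by rewrite divr_gt0.
  have [N HN] := Dn_cvg HS Hz Sz d2.
  have := HN N i 0 (leqnn _) (ltnW i3) I01_0;
    have := HN N i 1 (leqnn _) (ltnW i3) I01_1.
  rewrite /S (lincomb_periodic A N We i3).
  move: (Dn i _ 1) (Dn i z 0) (Dn i z 1) => p q r; rewrite !ler_norml; lra.
(* For [n > i] the product of [S n] with [e i] is already [A i]; Cauchy-Schwarz with [N4 (e i) = 1]
   carries this to the limit. *)
have In4_z i : In4 z (e i) = A i.
  apply/eqP; rewrite -subr_eq0 -normr_le0; apply/ler_addgt0Pr => d d0;
    rewrite add0r.
  move/cvgrPdist_le : Sz => /(_ d d0)[N _ HN].
  have := HN (maxn N i.+1) (leq_maxl _ _);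
    rewrite /= sub0r normrN ger0_norm ?N4_ge0//.
  set m := maxn _ _ => mN; apply: le_trans mN.
  have := In4_cauchy (H4_dif (HS m) Hz) (He i).
  rewrite {1}/dif In4_lin// In4_S leq_maxr mul1r mulN1r distrC.
  by rewrite (N4E (e i)) orth eqxx sqrtr1 mulr1.
exists z; split => // k.
have [n kn] := ubnP k; elim: n k kn => // n ih k kn.
have := AE k; rewrite -In4_z In4C In4_e//.
rewrite !big_ord_recr/= [X in X + _ = _ -> _](eq_bigr (fun i : 'I_k =>
  beta k i * Fk i)).
  move=> /addrI/(mulfI (beta_diag k)) <-; rewrite In4C psi_repr//.
by move=> i _; rewrite In4C psi_repr// ih// (leq_trans (ltn_ord i)).
Qed.

End convergence.

(** * From the points [t k] to the whole interval *)

Section limit_equation.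
Context {R : realType}.
Implicit Types (x : R).

Lemma I01_near x (d : R) : I01 x -> 0 < d ->
  exists w, [/\ I01 w, w != x & `|w - x| < d].
Proof.
move=> Ix d0; have PF := within01_proper Ix.
have : within I01 x^' [set w | I01 w /\ w != x /\ `|w - x| < d].
  by exists d => //= w; rewrite /ball_/= distrC.
by move=> /filter_ex[w [Iw [wx wd]]]; exists w.
Qed.

(** [0,1] has no isolated point, so discarding one term preserves density: [x] is first moved to a
    nearby [w] other than [t N], and the induction hypothesis is used in a ball around [w] that
    misses [t N]. *)
Lemma dense_tail (t : nat -> R) : I01 `<=` closure (range t) ->
  forall (N : nat) x (d : R), I01 x -> 0 < d ->
    exists k, (N <= k)%N /\ `|t k - x| < d.
Proof.
move=> td; elim=> [|N ih] x d Ix d0.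
  have := td x Ix (ball x d) (nbhsx_ballx _ _ d0).
  by move=> [_ [[k _ <-]]]; rewrite /ball/= distrC => kd; exists k.
have [w [Iw wN wd]] : exists w, [/\ I01 w, w != t N & `|w - x| < d].
  have [xN|xN] := eqVneq x (t N); first by rewrite -xN; exact: I01_near.
  by exists x; rewrite subrr normr0.
have d'0 : 0 < Num.min (d - `|w - x|) `|w - t N|.
  by rewrite lt_min subr_gt0 wd normr_gt0 subr_eq0.
have [k [Nk]] := ih w _ Iw d'0; rewrite lt_min => /andP[kd kN].
exists k; split.
  rewrite ltn_neqAle Nk andbT; apply/eqP => Nk'.
  by move: kN; rewrite -Nk' distrC ltxx.
rewrite (_ : t k - x = (t k - w) + (w - x)); last ring.
by rewrite (le_lt_trans (ler_normD _ _))// -ltrBrDr.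
Qed.

Lemma within_I01_continuous (F : R -> R -> R -> R -> R) :
  {within [set p : R * R * R * R | I01 p.1.1.1],
     continuous (fun p => F p.1.1.1 p.1.1.2 p.1.2 p.2)} ->
  forall x (a b c e : R), I01 x -> 0 < e -> exists2 d : R, 0 < d &
  forall s a' b' c', I01 s -> `|s - x| < d -> `|a' - a| < d -> `|b' - b| < d ->
    `|c' - c| < d -> `|F s a' b' c' - F x a b c| <= e.
Proof.
move=> Fc x a b c e Ix e0.
move/subspace_continuousP : Fc => /(_ (x, a, b, c) Ix)/cvgrPdist_le/(_ e e0).
move=> /nbhs_ballP[d /= d0 dF]; exists d => // s a' b' c' Is sx aa bb cc.
by rewrite distrC; apply: (dF (s, a', b', c')) => //; do !split;
  rewrite /ball/= distrC.
Qed.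

(** At a point [t k] near [x], the left side is close to [Dn 3 z x] by continuity. The arguments of
    [F] are close to those at [x] if moreover [k] is large, since they come from [S k]; [dense_tail]
    supplies such a [k]. *)
Lemma limit_equation (F : R -> R -> R -> R -> R) (t : nat -> R)
    (S : nat -> R -> R) (z : R -> R) :
  {within [set p : R * R * R * R | I01 p.1.1.1],
     continuous (fun p => F p.1.1.1 p.1.1.2 p.1.2 p.2)} ->
  (forall i, I01 (t i)) -> I01 `<=` closure (range t) ->
  (forall n, H4 (S n)) -> H4 z -> N4 (dif (S n) z) @[n --> \oo] --> (0 : R) ->
  (forall k, Dn 3 z (t k) = F (t k) (Dn 0 (S k) (t k)) (Dn 1 (S k) (t k)) (Dn 2
    (S k) (t k))) ->
  forall x, I01 x -> Dn 3 z x = F x (Dn 0 z x) (Dn 1 z x) (Dn 2 z x).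
Proof.
move=> Fc t01 td HS Hz Sz zE x Ix.
apply/eqP; rewrite -subr_eq0 -normr_le0; apply/ler_addgt0Pr => e e0;
  rewrite add0r.
have e2 : 0 < e / 2 by rewrite divr_gt0.
have [d d0 dF] := within_I01_continuous Fc (Dn 0 z x) (Dn 1 z x) (Dn 2 z x) Ix
  e2.
(* Two errors of at most [d / 3], from [S k] to [z] and from [t k] to [x], stay strictly below
   [d]. *)
have d3 : 0 < d / 3 by rewrite divr_gt0.
have [N HN] := Dn_cvg HS Hz Sz d3.
have [d' d'0 d'z] := ac01_unif (H4_ac Hz (isT : 3 < 4)%N) e2.
have [r0 r00 zr0] := ac01_unif (H4_ac Hz (isT : 0 < 4)%N) d3.
have [r1 r10 zr1] := ac01_unif (H4_ac Hz (isT : 1 < 4)%N) d3.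
have [r2 r20 zr2] := ac01_unif (H4_ac Hz (isT : 2 < 4)%N) d3.
have r_gt0 : 0 < Num.min d (Num.min d' (Num.min r0 (Num.min r1 r2))) by rewrite
  !lt_min d0 d'0 r00 r10.
have [k [Nk]] := dense_tail td N Ix r_gt0.
rewrite !lt_min => /and5P[kd kd' kr0 kr1 kr2].
have near i (r : R) : (i < 4)%N -> 
    `|Dn i z (t k) - Dn i z x| <= d / 3 -> `|Dn i (S k) (t k) - Dn i z x| < d.
  move=> i4; have := HN k i (t k) Nk i4 (t01 k).
  move: (Dn i (S k) _) (Dn i z _) (Dn i z x) => p q s;
    rewrite !ler_norml ltr_norml; lra.
have := dF (t k) _ _ _ (t01 k) kd (near 0 r0 isT (zr0 _ _ Ix (t01 k) kr0))
  (near 1 r1 isT (zr1 _ _ Ix (t01 k) kr1)) (near 2 r2 isT (zr2 _ _ Ix (t01 k)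
    kr2)).
rewrite -zE; have := d'z _ _ Ix (t01 k) kd'.
move: (Dn 3 z _) (Dn 3 z _) (F _ _ _ _) => p q s; rewrite !ler_norml; lra.
Qed.

End limit_equation.

(* Sequences are indexed from 0: t k, psi k, A k stand for the objects of
   index k + 1, while yn n is the n-term solution, so that yn k is the
   approximation preceding the (k + 1)-st point. *)
Theorem theorem4 (R : realType)
    (F : R -> R -> R -> R -> R)
    (F_cont : {within [set p : R * R * R * R | I01 p.1.1.1],
       continuous (fun p => F p.1.1.1 p.1.1.2 p.1.2 p.2)})
    (F_W21 : forall v1 v2 v3 : R -> R, W24 v1 -> W24 v2 -> W24 v3 ->
       W21 (fun s => F s (v1 s) (v2 s) (v3 s)))
    (Tadj : (R -> R) -> (R -> R))
    (Tadj_adjoint : is_adjoint_opT Tadj)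
    (t : nat -> R)
    (t_01 : forall i, I01 (t i))
    (t_inj : injective t)
    (t_dense : I01 `<=` closure (range t))
    (phi psi psibar : nat -> R -> R)
    (phiE : forall i, phi i = kerQ (t i))
    (psiE : forall i, psi i = Tadj (phi i))
    (psibarE : forall i, psibar i = gram_schmidt psi i)
    (beta : nat -> nat -> R)
    (betaE : forall i x, I01 x ->
       psibar i x = \sum_(k < i.+1) beta i k * psi k x)
    (A : nat -> R) (yn : nat -> R -> R)
    (AE : forall i, A i = \sum_(k < i.+1) beta i k *
       F (t k) (yn k (t k)) (derivn01 1 (yn k) (t k)) (derivn01 2 (yn k) (t k)))
    (ynE : forall n x, I01 x -> yn n x = \sum_(i < n) A i * psibar i x)
    (yn_bounded : exists M : R, forall n, norm4 (yn n) <= M) :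
  exists y : R -> R,
    [/\ W24 y,
        norm4 (fun x => yn n x - y x) @[n --> \oo] --> (0 : R),
        forall x, I01 x ->
          opT y x = F x (y x) (derivn01 1 y x) (derivn01 2 y x),
        [/\ y 0 - y 1 = 0, derivn01 1 y 0 - derivn01 1 y 1 = 0
          & derivn01 2 y 0 - derivn01 2 y 1 = 0]
      & forall x, I01 x ->
          series (fun i => A i * psibar i x) @ \oo --> y x].
Proof.
have [Tadj_W Tadj_in] := Tadj_adjoint.
have WQ i : W21 (phi i) by rewrite phiE; exact: W21_kerQ.
have Wpsi k : W24 (psi k) by rewrite psiE; exact: Tadj_W.
have psi_repr k w : W24 w -> In4 w (psi k) = Dn 3 w (t k).
  move=> Ww; rewrite -inner4In4 psiE -Tadj_in// phiE inner1_kerQ//.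
    by rewrite /opT DnE.
  by rewrite /opT DnE; apply: H4_ac => //; exact: W24_H4.
have eE : psibar = gram_schmidt psi by apply/funext.
pose e := gram_schmidt psi; pose S := lincomb A e.
(* [yn n] is prescribed on [0,1] only, while [S n] is a linear combination on the whole line;
   relative derivatives and norms do not distinguish them. *)
have SE n x : I01 x -> yn n x = S n x by move=> Ix; rewrite ynE// eE.
pose Fk k := F (t k) (Dn 0 (S k) (t k)) (Dn 1 (S k) (t k)) (Dn 2 (S k) (t k)).
have SD n i x : I01 x -> derivn01 i (yn n) x = Dn i (S n) x.
  by move=> Ix; rewrite DnE; apply: eq_Dn => // v; exact: SE.
have AE' i : A i = \sum_(k < i.+1) beta i k * Fk k.
  by rewrite AE; apply: eq_bigr => k _; rewrite !SD// SE// -[S k (t k)]/(S k (t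
    k)) /Fk Dn0.
have S_bounded : exists M : R, forall n, N4 (S n) <= M.
  have [M HM] := yn_bounded; exists M => n.
  by rewrite -(@eq_N4 _ (yn n))// -?norm4N4// => v; exact: SE.
have betaE' i x : I01 x -> gram_schmidt psi i x =
  \sum_(k < i.+1) beta i k * psi k x.
  by move=> Ix; rewrite -eE betaE.
have [z [Wz Sz zE]] := gram_schmidt_expansion_cvg t_01 t_inj Wpsi psi_repr
  betaE' AE' S_bounded.
have Hz := W24_H4 Wz.
have He k : H4 (e k) by apply: gram_schmidt_H4 => i; exact: W24_H4.
have HS n : H4 (S n) by exact: H4_lincomb.
have /W24P[_ per] := Wz.
exists z; split => //.
- apply: cvg_trans Sz; apply: near_eq_cvg; apply: nearW => n.
  by rewrite norm4N4; apply: eq_N4 => v Iv; rewrite /dif mul1r mulN1r SE.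
- move=> x Ix; rewrite /opT DnE (limit_equation F_cont t_01 t_dense HS Hz Sz zE
  Ix).
  by rewrite Dn0.
- rewrite DnE; split; apply/eqP; rewrite subr_eq0; apply/eqP.
  + by have := per 0 isT; rewrite Dn0.
  + exact: per.
  + exact: per.
(* The partial sums of the series are the values of [S n], so this is the order 0 case of the
   uniform convergence in [Dn_cvg]. *)
- move=> x Ix; apply/cvgrPdist_le => d d0.
  have [N HN] := Dn_cvg HS Hz Sz d0; exists N => // n /= Nn.
  have := HN n 0 x Nn isT Ix; rewrite !Dn0 distrC;
    congr (is_true (`|_ - _| <= _)).
  by rewrite /series/= big_mkord eE.
Qed.
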